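(* Fix an integer $r>2$. Consider pairs $(q,a)$ where $q$ is a prime power with $q\ge r$ and $q+1\equiv 0\pmod r$, and $a\in\mathbb{F}_{q^2}^*$ with $a^{q+1}\ne 1$. Then there are only finitely many such pairs $(q,a)$ for which $f=aX+X^{r(q-1)+1}$ is a permutation polynomial of $\mathbb{F}_{q^2}$.
   Context: A polynomial $f\in\mathbb{F}_{Q}[X]$ is a permutation polynomial of $\mathbb{F}_Q$ if the map $x\mapsto f(x)$ is a bijection of $\mathbb{F}_Q$. *)

(* Defs.v *)
From HB Require Import structures.
From mathcomp Require Import all_boot all_order all_algebra all_field.
From mathcomp Require Import boolp classical_sets functions cardinality.
Set Implicit Arguments.
Unset Strict Implicit.
Unset Printing Implicit Defensive.
Import GRing.Theory.
Local Open Scope ring_scope.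

Definition prime_power (q : nat) : Prop :=
  exists p k : nat, [/\ prime p, (0 < k)%N & q = (p ^ k)%N].

(* [F Q] plays the role of "the" field with Q elements, unique only up to
   isomorphism; the values of [F] outside prime powers are irrelevant. *)
Definition galois_fields (F : nat -> finFieldType) : Prop :=
  forall Q : nat, prime_power Q -> #|F Q| = Q.

Definition permutation_polynomial (K : finFieldType) (f : {poly K}) : Prop :=
  bijective (fun x : K => f.[x]).

Lemma galois_fields_exist : exists F : nat -> finFieldType, galois_fields F.
Proof.
have H (Q : nat) : exists K : finFieldType, prime_power Q -> #|K| = Q.
  have [[p [k [p_pr k_gt0 ->]]]|nQ] := pselect (prime_power Q).
    by have [K _ cardK] := pPrimePowerField p_pr k_gt0; exists K.
  by exists 'F_2.
have [F FP] := choice H.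
by exists F.
Qed.

(* Main.v *)
(* Put A = Y^(r-1) (Y^r + a), B = a^q Y^r + 1 and n = 2r - 1. If f permutes
   F_(q^2), then A/B permutes the group mu of (q+1)-st roots of unity, so the
   product of A(u) - V B(u) over u in mu is a constant times 1 - V^(q+1). In terms
   of the n roots y_i of A - V B over k(V), with k an algebraic closure of
   F_(q^2), this reads
       prod_i (y_i^(q+1) - 1) = beta (1 - V^(q+1)).
   At V = 0, r - 1 of the roots are small and the other r are congruent to
   r-th roots c_i of -a. Hence y_i^(q+1) is close to y_i z_i, where z_i = 0 for the
   small roots and z_i = c_i^q for the others, and prod_i (y_i z_i - 1) - beta
   vanishes at V = 0 to an order proportional to q. The product of its
   conjugates under the permutations of the roots is a polynomial in V whose
   degree is bounded in terms of r only. So for large q it is zero, and after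
   renumbering the roots prod_i (y_i z_i - 1) = beta holds exactly.
   Next look at V = infinity. Exactly r - 1 roots have a pole there, of order
   1/(r-1), and y_i z_i - 1 can only vanish to order 1. Therefore the set of poles
   is either the set T of the r - 1 indices with z_i = 0, or disjoint from T. This
   holds for all conjugates under the Galois group, which acts transitively on
   the roots. So T is a block, r - 1 divides 2r - 1, and r = 2. *)

Require Import Defs.
From HB Require Import structures.
From mathcomp Require Import all_boot all_order all_fingroup all_algebra all_field.
From mathcomp Require Import boolp classical_sets functions cardinality.
From mathcomp Require Import generic_quotient ring zify.
Set Implicit Arguments.
Unset Strict Implicit.
Unset Printing Implicit Defensive.
Import GRing.Theory.
Local Open Scope ring_scope.

(** * Valuation rings *)

Definition subring_set (L : fieldType) (A : set L) : Prop :=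
  [/\ A 1, forall x y, A x -> A y -> A (x - y)
    & forall x y, A x -> A y -> A (x * y)].

Definition valuation_ring (L : fieldType) (O : set L) : Prop :=
  subring_set O /\ forall x, O x \/ O x^-1.

Section SubringSet.
Local Open Scope classical_set_scope.
Variables (L : fieldType) (A : set L).
Hypothesis ringA : subring_set A.

Lemma subring_set1 : A 1. Proof. by case: ringA. Qed.
Lemma subring_setB x y : A x -> A y -> A (x - y).
Proof. by case: ringA => _ + _; apply. Qed.
Lemma subring_setM x y : A x -> A y -> A (x * y).
Proof. by case: ringA => _ _; apply. Qed.
Lemma subring_set0 : A 0.
Proof. by rewrite -(subrr 1); apply: subring_setB subring_set1 subring_set1. Qed.
Lemma subring_setN x : A x -> A (- x).
Proof. by rewrite -sub0r; apply: subring_setB subring_set0. Qed.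
Lemma subring_setD x y : A x -> A y -> A (x + y).
Proof. by move=> Ax /subring_setN Ay; rewrite -[y]opprK; apply: subring_setB. Qed.
Lemma subring_setX x n : A x -> A (x ^+ n).
Proof.
move=> Ax; elim: n => [|n IH]; first exact: subring_set1.
by rewrite exprS; exact: subring_setM.
Qed.
Lemma subring_set_sum I (s : seq I) (P : pred I) F :
  (forall i, P i -> A (F i)) -> A (\sum_(i <- s | P i) F i).
Proof. by move=> AF; apply: big_ind => //; [exact: subring_set0 | exact: subring_setD]. Qed.
Lemma subring_set_prod I (s : seq I) (P : pred I) F :
  (forall i, P i -> A (F i)) -> A (\prod_(i <- s | P i) F i).
Proof. by move=> AF; apply: big_ind => //; [exact: subring_set1 | exact: subring_setM]. Qed.

Definition adjoin_set (z : L) : set L :=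
  [set w | exists2 p : {poly L}, (forall i, A p`_i) & w = p.[z]].

Lemma subring_adjoin_set z : subring_set (adjoin_set z).
Proof.
split.
- exists 1; last by rewrite hornerE.
  by move=> i; rewrite coef1; case: eqP => _; [exact: subring_set1 | exact: subring_set0].
- move=> _ _ [p Ap ->] [q Aq ->]; exists (p - q); last by rewrite !hornerE.
  by move=> i; rewrite coefB; exact: subring_setB.
- move=> _ _ [p Ap ->] [q Aq ->]; exists (p * q); last by rewrite !hornerE.
  by move=> i; rewrite coefM; apply: subring_set_sum => j _; exact: subring_setM.
Qed.

Lemma sub_adjoin_set z : A `<=` adjoin_set z.
Proof.
move=> x Ax; exists x%:P; last by rewrite hornerC.
by move=> i; rewrite coefC; case: eqP => _ //; exact: subring_set0.
Qed.

Lemma mem_adjoin_set z : adjoin_set z z.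
Proof.
exists 'X; last by rewrite hornerX.
by move=> i; rewrite coefX; case: eqP => _; [exact: subring_set1 | exact: subring_set0].
Qed.

End SubringSet.

Section Chevalley.
Local Open Scope classical_set_scope.
Variables (L : fieldType) (B : set L) (x : L).
Hypotheses (ringB : subring_set B) (Bx : B x) (nBx : ~ B x^-1).
Hypothesis maxB : forall C, subring_set C -> B `<=` C -> ~ C x^-1 -> C `<=` B.

Lemma maximal_adjoin z : ~ B z -> adjoin_set B z x^-1.
Proof.
move=> nBz; apply: contrapT => nadj; apply: nBz.
apply: (maxB _ (@sub_adjoin_set _ _ ringB z)) => //; first exact: subring_adjoin_set.
exact: mem_adjoin_set.
Qed.

Lemma maximal_x_neq0 : x != 0.
Proof. by apply: contra_notN nBx => /eqP->; rewrite invr0; exact: subring_set0. Qed.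

(** This puts x into the Jacobson radical of [B]. If 1/d were outside [B], where d = 1 - x c, then
    1/x would be a polynomial in 1/d over [B], and multiplying by a power of d gives d^N = x b.
    Since also d^N = 1 - x e, the element 1/x = b + e would lie in [B]. *)
Lemma maximal_unit c : B c -> 1 - x * c != 0 /\ B (1 - x * c)^-1.
Proof.
move=> Bc; set d := 1 - x * c.
have x0 := maximal_x_neq0.
have Bd : B d by apply: subring_setB (subring_set1 ringB) _ => //; apply: subring_setM.
have d0 : d != 0.
  apply/eqP => d0; apply: nBx.
  suff -> : x^-1 = c by [].
  by apply: (mulfI x0); rewrite divff //; apply/eqP; rewrite -subr_eq0 -/d d0.
split=> //; apply: contrapT => /maximal_adjoin [p Bp xp].
have dX N : exists2 e, B e & d ^+ N = 1 - x * e.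
  elim: N => [|N [e Be IH]].
    by exists 0; [exact: subring_set0 | rewrite mulr0 subr0 expr0].
  exists (c + e - x * (c * e)); last by rewrite exprS IH /d; ring.
  apply: subring_setB => //; first exact: subring_setD.
  by apply: subring_setM => //; apply: subring_setM.
have [e Be de] := dX (size p).
pose b := \sum_(i < size p) p`_i * d ^+ (size p - i).
have Bb : B b.
  by apply: subring_set_sum => // i _; apply: subring_setM => //; apply: subring_setX.
have db : d ^+ size p = x * b.
  apply: (mulfI (invr_neq0 x0)); rewrite mulKf // xp horner_coef mulr_suml.
  apply: eq_bigr => i _; rewrite -mulrA; congr (_ * _).
  by rewrite exprVn mulrC -expfB ?ltn_ord.
apply: nBx; suff -> : x^-1 = b + e by apply: subring_setD.
apply: (mulfI x0); rewrite divff // mulrDr -db de subrK //.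
Qed.

End Chevalley.

(* If z and 1/z both yield expressions of 1/x, then the leading term of the
   longer one can be eliminated with the help of the shorter one. *)
Section ChevalleyStep.
Variables (L : fieldType) (B : set L) (x : L).
Hypotheses (ringB : subring_set B) (Bx : B x) (nBx : ~ B x^-1).
Hypothesis unitB : forall c, B c -> 1 - x * c != 0 /\ B (1 - x * c)^-1.

Let x0 : x != 0.
Proof. by apply: contra_notN nBx => /eqP->; rewrite invr0; exact: subring_set0. Qed.

Let expr_size z n := exists p : {poly L},
  [/\ forall i, B p`_i, (size p <= n.+1)%N & x^-1 = p.[z]].

Let reduce_degree z n m : z != 0 -> (m <= n.+1)%N ->
  expr_size z n.+1 -> expr_size z^-1 m -> expr_size z n.
Proof.
move=> z0 mn [p [Bp sp xp]] [q [Bq sq xq]].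
have [d0 Bd] := unitB (Bq 0).
(* Multiplied by z^(n+1), the relation 1/x = q(1/z) expresses (1/x)(1 - x q_0) z^(n+1) by lower
   powers of z. The factor [u], an element of [B], turns the left side into z^(n+1). *)
pose u := x * (1 - x * q`_0)^-1.
have Bu : B u by apply: subring_setM.
exists (\poly_(i < n.+1) (p`_i + p`_n.+1 * u * q`_(n.+1 - i))).
split; last 2 first.
- exact: size_poly.
- rewrite xp (horner_coef_wide z sp) (horner_coef_wide z (size_poly _ _)).
  rewrite big_ord_recr /=.
  under [in RHS]eq_bigr => i _ do rewrite coef_poly ltn_ord mulrDl.
  rewrite big_split /=; congr (_ + _).
  under eq_bigr => i _ do rewrite -!mulrA.
  rewrite -!mulr_sumr; congr (_ * _).
  have sq' : (size q <= n.+2)%N by apply: leq_trans sq _.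
  have : z ^+ n.+1 * x^-1 = z ^+ n.+1 * q`_0 + \sum_(i < n.+1) q`_(n.+1 - i) * z ^+ i.
    rewrite xq (horner_coef_wide _ sq') big_ord_recl /= expr0 mulr1 mulrDr; congr (_ + _).
    rewrite mulr_sumr [RHS](reindex_inj rev_ord_inj) /=; apply: eq_bigr => i _.
    have lt_i := ltn_ord i.
    have -> : (n.+1 - (n.+1 - i.+1) = i.+1)%N by lia.
    by rewrite /bump /= add1n mulrCA exprVn -expfB_cond ?(negPf z0).
  move=> /(congr1 (fun w => w - z ^+ n.+1 * q`_0)); rewrite addrAC subrr add0r => <-.
  rewrite /u -mulrBr.
  have -> : x^-1 - q`_0 = x^-1 * (1 - x * q`_0) by rewrite mulrBr mulr1 mulKf.
  by field; rewrite x0 d0.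
move=> i; rewrite coef_poly; case: ifP => _; last exact: subring_set0.
by apply: subring_setD => //; apply: subring_setM => //; apply: subring_setM.
Qed.

Lemma local_adjoin_dichotomy z : adjoin_set B z x^-1 -> adjoin_set B z^-1 x^-1 -> False.
Proof.
move=> [p Bp xp] [q Bq xq].
have not0 w : ~ expr_size w 0.
  move=> [s [Bs ss xs]]; apply: nBx; rewrite xs (size1_polyC ss) hornerC //.
have z0 : z != 0.
  apply/eqP => z0; apply: nBx; rewrite xp z0 horner_coef0 //.
have : exists k, exists n m, [/\ (n + m <= k)%N, expr_size z n & expr_size z^-1 m].
  exists (size p + size q)%N, (size p), (size q); split => //.
  - by exists p; split => //; apply: leqW.
  - by exists q; split => //; apply: leqW.
move=> [k]; elim: k => [|k IH] [[|n] [[|m] [nm zn zm]]] //;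
  try exact: (not0 _ zn); try exact: (not0 _ zm).
apply: IH; have [mn|nm'] := leqP m n.
  exists n, m.+1; split => //; exact: (reduce_degree z0 _ zn zm).
exists n.+1, m; split => //; first by rewrite -ltnS -addnS.
apply: (@reduce_degree z^-1 m n.+1) => //; first by rewrite invr_eq0.
  exact: ltnW.
by rewrite invrK.
Qed.

End ChevalleyStep.

Section ChevalleyExtension.
Local Open Scope classical_set_scope.

(** Zorn's lemma gives a maximal B among the subrings that contain A but not 1/x. If neither z nor
    1/z lay in B, both B[z] and B[1/z] would contain 1/x, which [local_adjoin_dichotomy]
    excludes. *)
Theorem chevalley_extension (L : fieldType) (A : set L) (x : L) :
  subring_set A -> A x -> ~ A x^-1 ->
  exists O, [/\ valuation_ring O, A `<=` O & ~ O x^-1].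
Proof.
move=> ringA Ax nAx.
pose P := [set B : set L | B = set0 \/ [/\ subring_set B, A `<=` B & ~ B x^-1]].
have [] := @Zorn_bigcup L P.
  move=> F FP totF.
  have [[X FX [w Xw]]|noX] := pselect (exists2 X, F X & exists w, X w); last first.
    left; apply/seteqP; split => // w [X FX Xw]; apply: noX.
    by exists X => //; exists w.
  have inh Y v : F Y -> Y v -> [/\ subring_set Y, A `<=` Y & ~ Y x^-1].
    by move=> FY Yv; have [Y0|//] := FP _ FY; move: Yv; rewrite Y0.
  have two u v : (\bigcup_(X in F) X) u -> (\bigcup_(X in F) X) v ->
      exists Y, [/\ F Y, Y u, Y v & subring_set Y].
    move=> [Y FY Yu] [Z FZ Zv].
    have [rY _ _] := inh _ _ FY Yu; have [rZ _ _] := inh _ _ FZ Zv.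
    by have [YZ|ZY] := totF _ _ FY FZ; [exists Z | exists Y]; split=> //; [exact: YZ|exact: ZY].
  right; have [rX AX _] := inh _ _ FX Xw; split.
  - split.
    + by exists X => //; exact: subring_set1.
    + move=> u v /two/[apply] -[Y [FY Yu Yv rY]]; exists Y => //; exact: subring_setB.
    + move=> u v /two/[apply] -[Y [FY Yu Yv rY]]; exists Y => //; exact: subring_setM.
  - by move=> u Au; exists X => //; apply: AX.
  - by move=> [Y FY Yx]; have [_ _] := inh _ _ FY Yx; apply.
move=> B [[B0|[ringB AB nBx]] maxB].
  exfalso; apply: (maxB A); last by right; split.
  by split; [rewrite B0 => ? [] | move=> /(_ 1); rewrite B0; apply; exact: subring_set1].
exists B; split=> //; split=> // z.
have maxB' C : subring_set C -> B `<=` C -> ~ C x^-1 -> C `<=` B.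
  move=> rC BC nCx; apply: contrapT => nCB; apply: (maxB C); first by split.
  by right; split=> //; exact: subset_trans BC.
have [Bz|nBz] := pselect (B z); first by left.
have [Bz'|nBz'] := pselect (B z^-1); first by right.
exfalso; apply: (@local_adjoin_dichotomy L B x ringB (AB _ Ax) nBx _ z).
- by move=> c Bc; apply: maximal_unit => //; exact: AB.
- exact: maximal_adjoin.
- exact: maximal_adjoin.
Qed.

End ChevalleyExtension.

(** * Splitting fields *)

Lemma irreducible_factor (F : fieldType) (p : {poly F}) :
  (1 < size p)%N -> exists2 r : {poly F}, r %| p & irreducible_poly r.
Proof.
move=> p1; pose Q n := `[< exists r : {poly F}, [/\ r %| p, (1 < size r)%N & size r = n] >].
have exQ : exists n, Q n by exists (size p); apply/asboolP; exists p; rewrite dvdpp.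
have [_ /asboolP[r [rp r1 <-]] minQ] := ex_minnP exQ.
exists r => //; split=> // s s1 sr.
have r0 : r != 0 by rewrite -size_poly_gt0 ltnW.
have s0 : s != 0 by apply: contraNneq r0 => s0; rewrite s0 dvd0p in sr.
rewrite -dvdp_size_eqp // eqn_leq dvdp_leq //= minQ //; apply/asboolP; exists s.
by rewrite (dvdp_trans sr rp) ltn_neqAle eq_sym s1 size_poly_gt0.
Qed.

Lemma exists_split_extension n (F : fieldType) (p : {poly F}) :
  p != 0 -> (size p <= n)%N ->
  exists (L : fieldExtType F) (zs : seq L),
    map_poly (in_alg L) p %= \prod_(z <- zs) ('X - z%:P).
Proof.
elim: n => [|n IH] in F p *.
  by move=> p0; rewrite leqn0 size_poly_eq0 (negPf p0).
move=> p0 sp; have [p1|p1] := leqP (size p) 1.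
  exists F^o, [::]; rewrite big_nil -size_poly_eq1 size_map_poly eqn_leq p1.
  by rewrite size_poly_gt0.
have [r rp irr_r] := irreducible_factor p1.
have [K _ [x rx0 _]] := irredp_FAdjoin irr_r.
have /factor_theorem[s Ds] : root (map_poly (in_alg K) p) x.
  by rewrite -(divpK rp) rmorphM rootM rx0 orbT.
have sizes : size p = size (s * ('X - x%:P)) by rewrite -Ds size_map_poly.
have s0 : s != 0.
  by apply: contraNneq p0 => s0; rewrite -size_poly_eq0 sizes s0 mul0r size_poly0.
have [|L [zs Dzs]] := IH K s s0.
  by move: sp; rewrite sizes size_mul ?polyXsubC_eq0 // size_XsubC addn2.
exists (baseFieldType L), (in_alg L x :: zs); rewrite big_cons.
have -> : map_poly (in_alg (baseFieldType L)) p
    = map_poly (in_alg L) (map_poly (in_alg K) p).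
  rewrite -map_poly_comp; apply: eq_map_poly => c /=.
  exact: (baseField_scaleE c (1 : L)).
by rewrite Ds rmorphM /= rmorphB /= map_polyX map_polyC mulrC eqp_mull.
Qed.

(** The extension from [exists_split_extension] may be too large; the subfield generated by the
    roots is cut out of it, and the roots are pulled back to that subfield. *)
Lemma exists_splitting_field (F : fieldType) (p : {poly F}) : p != 0 ->
  exists L : splittingFieldType F, splittingFieldFor 1 (map_poly (in_alg L) p) {:L}.
Proof.
move=> p0; have [L0 [zs Dzs]] := exists_split_extension p0 (leqnn _).
pose L : fieldExtType F := subvs_of <<1 & zs>>.
have splitL : splittingFieldFor 1 (map_poly (in_alg L) p) {:L}.
  pose toL := linfun (vsval : L -> L0).
  pose ys : seq L := map (vsproj _) zs.
  have ysE : map toL ys = zs.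
    rewrite -map_comp map_id_in // => z zs_z /=.
    by rewrite lfunE /= vsprojK ?seqv_sub_adjoin.
  exists ys.
    rewrite -(eqp_map toL) rmorph_prod -map_poly_comp.
    have -> : map_poly (toL \o in_alg L) p = map_poly (in_alg L0) p.
      by apply: eq_map_poly => c; exact: rmorph_alg.
    rewrite -ysE big_map in Dzs.
    have -> // : \prod_(z <- ys) map_poly toL ('X - z%:P)
        = \prod_(z <- ys) ('X - (toL z)%:P).
    by apply: eq_bigr => z _; rewrite rmorphB /= map_polyX map_polyC.
  apply/vspaceP => u; rewrite memvf.
  have : val u \in (toL @: <<1 & ys>>)%VS.
    by rewrite aimg_adjoin_seq aimg1 ysE (valP u).
  by case/memv_imgP => v ys_v; rewrite lfunE => /val_inj ->.
have axL : SplittingField.axiom L.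
  by exists (map_poly (in_alg L) p) => //; exact: alg_polyOver.
pose splitM := FieldExt_isSplittingField.Build F L axL.
by exists (HB.pack_for (splittingFieldType F) L splitM).
Qed.

(** * Units, maximal ideal and comparison of valuations *)

Section ValuationRing.
Variables (L : fieldType) (O : set L).
Hypothesis valO : valuation_ring O.

Let ringO : subring_set O. Proof. by case: valO. Qed.

(** The inverse of 0 is 0 here, so 0 has to be excluded explicitly. *)
Definition vunit (x : L) : Prop := [/\ x != 0, O x & O x^-1].
Definition vmax (x : L) : Prop := O x /\ ~ vunit x.
(** Equality of the valuations of x and y, expressed without a value group. *)
Definition vassoc (x y : L) : Prop := exists2 u, vunit u & x = u * y.

Lemma vunit_neq0 x : vunit x -> x != 0. Proof. by case. Qed.
Lemma vunit_mem x : vunit x -> O x. Proof. by case. Qed.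
Lemma vunit1 : vunit 1.
Proof. by split; rewrite ?oner_eq0 ?invr1 //; exact: subring_set1. Qed.
Lemma vunitV x : vunit x -> vunit x^-1.
Proof. by case=> *; split; rewrite ?invr_eq0 ?invrK. Qed.
Lemma vunitM x y : vunit x -> vunit y -> vunit (x * y).
Proof.
case=> x0 Ox Oxi [y0 Oy Oyi]; split; rewrite ?mulf_neq0 //; first exact: subring_setM.
by rewrite invfM; exact: subring_setM.
Qed.
Lemma vunitX x n : vunit x -> vunit (x ^+ n).
Proof. by move=> ux; elim: n => [|n IH]; [exact: vunit1 | rewrite exprS; exact: vunitM]. Qed.
Lemma vunitN x : vunit x -> vunit (- x).
Proof. by case=> *; split; rewrite ?oppr_eq0 ?invrN //; exact: subring_setN. Qed.

Lemma vunit_or_vmax x : O x -> vunit x \/ vmax x.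
Proof. by move=> Ox; have [|] := pselect (vunit x); [left|right; split]. Qed.

Lemma vmax_mem x : vmax x -> O x. Proof. by case. Qed.

Lemma vmax_inv x : ~ O x -> vmax x^-1.
Proof.
move=> nOx; split; first by case: valO => _ /(_ x) [].
by move=> [_ _]; rewrite invrK.
Qed.

Lemma vmaxP x : O x -> x != 0 -> ~ O x^-1 -> vmax x.
Proof. by move=> Ox x0 nOx; split => // -[]. Qed.

Lemma vmaxMl x y : O x -> vmax y -> vmax (x * y).
Proof.
move=> Ox [Oy nuy]; split; first exact: subring_setM.
case; rewrite mulf_eq0 negb_or => /andP[x0 y0] _ Oxy; apply: nuy; split=> //.
have -> : y^-1 = x * (x * y)^-1 by rewrite invfM mulrA mulfV // mul1r.
exact: subring_setM.
Qed.

Lemma vmaxN x : vmax x -> vmax (- x).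
Proof.
by move=> mx; rewrite -mulN1r; apply: vmaxMl => //; apply: subring_setN => //; exact: subring_set1.
Qed.

Lemma vmaxD x y : vmax x -> vmax y -> vmax (x + y).
Proof.
have [->|x0] := eqVneq x 0; first by rewrite add0r.
have [->|y0] := eqVneq y 0; first by rewrite addr0.
move=> mx my; have [Oxy|] := valO.2 (x / y).
  have -> : x + y = (x / y + 1) * y by rewrite mulrDl divfK // mul1r.
  by apply: vmaxMl => //; apply: subring_setD => //; exact: subring_set1.
rewrite invf_div => Oyx.
have -> : x + y = (1 + y / x) * x by rewrite mulrDl divfK // mul1r.
by apply: vmaxMl => //; apply: subring_setD => //; exact: subring_set1.
Qed.

Lemma vmaxX x n : (0 < n)%N -> vmax x -> vmax (x ^+ n).
Proof.
case: n => // n _ mx; rewrite exprSr; apply: vmaxMl => //.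
by apply: subring_setX => //; exact: vmax_mem.
Qed.

Lemma vmax_sum I (s : seq I) (P : pred I) F :
  (forall i, P i -> vmax (F i)) -> vmax (\sum_(i <- s | P i) F i).
Proof.
move=> mF; apply: big_ind => //; last exact: vmaxD.
by split; [exact: subring_set0 | case; rewrite eqxx].
Qed.

Lemma vunit_vmaxN x : vunit x -> ~ vmax x. Proof. by move=> ux []. Qed.

Lemma vunitDr x y : vunit x -> vmax y -> vunit (x + y).
Proof.
move=> ux my; have [] // := @vunit_or_vmax (x + y).
  by apply: subring_setD (vunit_mem ux) (vmax_mem my).
by move=> /vmaxD/(_ (vmaxN my)); rewrite addrK => /(vunit_vmaxN ux).
Qed.

Lemma vassoc_refl x : vassoc x x. Proof. by exists 1; [exact: vunit1 | rewrite mul1r]. Qed.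
Lemma vassoc_unit x : vunit x -> vassoc x 1. Proof. by exists x; rewrite ?mulr1. Qed.
Lemma vassoc_sym x y : vassoc x y -> vassoc y x.
Proof. by move=> [u uu ->]; exists u^-1; [exact: vunitV | rewrite mulKf // vunit_neq0]. Qed.
Lemma vassoc_trans x y z : vassoc x y -> vassoc y z -> vassoc x z.
Proof. by move=> [u uu ->] [v uv ->]; exists (u * v); [exact: vunitM | rewrite mulrA]. Qed.
Lemma vassocM x y x' y' : vassoc x y -> vassoc x' y' -> vassoc (x * x') (y * y').
Proof. by move=> [u uu ->] [v uv ->]; exists (u * v); [exact: vunitM | rewrite mulrACA]. Qed.
Lemma vassocV x y : vassoc x y -> vassoc x^-1 y^-1.
Proof. by move=> [u uu ->]; exists u^-1; [exact: vunitV | rewrite invfM]. Qed.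
Lemma vassoc_prod I (s : seq I) (P : pred I) F G :
  (forall i, P i -> vassoc (F i) (G i)) ->
  vassoc (\prod_(i <- s | P i) F i) (\prod_(i <- s | P i) G i).
Proof. by move=> FG; apply: big_ind2 => //; [exact: vassoc_refl | move=> *; exact: vassocM]. Qed.
Lemma vassocX x y n : vassoc x y -> vassoc (x ^+ n) (y ^+ n).
Proof. by move=> [u uu ->]; exists (u ^+ n); [exact: vunitX | rewrite exprMn]. Qed.

(** A positive power of x lies in the maximal ideal and is no unit; exponents of x thus serve as
    integer valuations. *)
Lemma vassoc_exp_inj x i j : vmax x -> x != 0 -> vassoc (x ^+ i) (x ^+ j) -> i = j.
Proof.
move=> mx x0; wlog ij : i j / (i <= j)%N.
  by move=> H; have [/H//|/ltnW/H{}H /vassoc_sym/H] := leqP i j.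
move=> /vassoc_sym; have [<-//|lt_ij] := eqVneq i j.
move=> [u uu /eqP]; rewrite -(subnK ij) exprD (inj_eq (mulIf _)) ?expf_neq0 // => /eqP xu.
case: (vunit_vmaxN uu); rewrite -xu; apply: vmaxX => //; rewrite subn_gt0 ltn_neqAle lt_ij //.
Qed.

Lemma vassoc_exp_le x i j w : vmax x -> x != 0 -> O w -> vassoc (x ^+ i) (w * x ^+ j) ->
  (j <= i)%N.
Proof.
move=> mx x0 Ow [u uu /eqP]; case: leqP => // lt_ij.
rewrite -(subnK (ltnW lt_ij)) exprD !mulrA -[X in X == _]mul1r.
rewrite (inj_eq (mulIf _)) ?expf_neq0 // => /eqP e.
case: (vunit_vmaxN vunit1); rewrite e.
apply: vmaxMl; first by apply: subring_setM => //; exact: vunit_mem.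
by apply: vmaxX => //; rewrite subn_gt0.
Qed.

(* Modulo the maximal ideal the second factor of x^n - c^n is n c^(n-1). *)
Lemma vunit_sum_powers x c n : vunit c -> vunit (n%:R : L) -> vmax (x - c) ->
  vunit (\sum_(i < n) x ^+ (n.-1 - i) * c ^+ i).
Proof.
move=> uc un mxc.
have mX j : vmax (x ^+ j - c ^+ j).
  rewrite subrXX mulrC; apply: vmaxMl => //; apply: subring_set_sum => // i _.
  apply: subring_setM => //; apply: subring_setX => //; last exact: vunit_mem.
  by rewrite -[x](subrK c); apply: subring_setD (vmax_mem mxc) (vunit_mem uc).
have -> : \sum_(i < n) x ^+ (n.-1 - i) * c ^+ i =
   n%:R * c ^+ n.-1 + \sum_(i < n) (x ^+ (n.-1 - i) - c ^+ (n.-1 - i)) * c ^+ i.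
  transitivity (\sum_(i < n) (c ^+ n.-1 + (x ^+ (n.-1 - i) - c ^+ (n.-1 - i)) * c ^+ i)).
    apply: eq_bigr => i _; have lt_i := ltn_ord i.
    by rewrite mulrBl -exprD subnK; [rewrite addrC subrK | lia].
  by rewrite big_split /= sumr_const card_ord mulr_natl.
apply: vunitDr; first by apply: vunitM => //; exact: vunitX.
apply: vmax_sum => i _; rewrite mulrC; apply: vmaxMl => //.
by apply: subring_setX => //; exact: vunit_mem.
Qed.

End ValuationRing.

(** * The roots of A - V B *)

(* A(Y) - V B(Y), where A = Y^(r-1) (Y^r + a) and B = b Y^r + 1; later b = a^q. *)
Definition psi (R : comNzRingType) (r : nat) (a b V : R) : {poly R} :=
  'X^(r.-1) * ('X^r + a%:P) - V%:P * (b%:P * 'X^r + 1).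

Lemma horner_psi (R : comNzRingType) (r : nat) (a b V x : R) :
  (psi r a b V).[x] = x ^+ r.-1 * (x ^+ r + a) - V * (b * x ^+ r + 1).
Proof. by rewrite /psi !hornerE ?hornerXn. Qed.

Section Roots.
Variables (k L : fieldType) (kappa : {rmorphism k -> L}) (O : set L) (V : L).
Variables (r : nat) (a b : k).
Hypotheses (valO : valuation_ring O) (Ok : forall c, O (kappa c)).
Hypotheses (r_gt1 : (1 < r)%N) (r_neq0 : r%:R != 0 :> k).
Hypotheses (a0 : a != 0) (b0 : b != 0) (ab1 : a * b != 1) (V0 : V != 0).

Let ringO : subring_set O. Proof. by case: valO. Qed.

Let r_gt0 : (0 < r)%N. Proof. exact: ltnW. Qed.

Let r1_gt0 : (0 < r.-1)%N. Proof. by rewrite -ltnS prednK. Qed.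

Lemma vunit_const c : c != 0 -> vunit O (kappa c).
Proof. by move=> c0; split; rewrite ?fmorph_eq0 // -fmorphV. Qed.

Let vunit_r : vunit O (r%:R : L).
Proof. by rewrite -(rmorph_nat kappa); exact: vunit_const. Qed.

Let vunitD1 x c : c != 0 -> vmax O x -> vunit O (kappa c + x).
Proof. by move=> c0; apply: vunitDr => //; exact: vunit_const. Qed.

Let vunit1D x : vmax O x -> vunit O (1 + x).
Proof. by rewrite -(rmorph1 kappa); apply: vunitD1; exact: oner_neq0. Qed.

Section OneRoot.
Variable y : L.
Hypothesis rooty : root (psi r (kappa a) (kappa b) V) y.

Let rooty_eq : y ^+ r.-1 * (y ^+ r + kappa a) = V * (kappa b * y ^+ r + 1).
Proof. by move: rooty; rewrite /root horner_psi subr_eq0 => /eqP. Qed.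

(** With w = 1/y in the maximal ideal, the equation reads y^(r-1) (1 + a w^r) = V (b + w^r), and
    both brackets are units. *)
Lemma pole_root : ~ O y -> vassoc O (y ^+ r.-1) V.
Proof.
move=> nOy; have mw := vmax_inv valO nOy.
have y0 : y != 0 by apply: contra_notN nOy => /eqP->; exact: subring_set0.
have mwr : vmax O (y^-1 ^+ r) by exact: vmaxX.
have e : y ^+ r.-1 * (1 + kappa a * y^-1 ^+ r) = V * (kappa b + y^-1 ^+ r).
  apply: (mulIf (expf_neq0 r y0)); rewrite -!mulrA !mulrDl -!mulrA -!exprMn mulVf // expr1n.
  by rewrite mul1r !mulr1.
have u1 : vunit O (1 + kappa a * y^-1 ^+ r) by apply: vunit1D; exact: vmaxMl.
have u2 : vunit O (kappa b + y^-1 ^+ r) by exact: vunitD1.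
exists ((kappa b + y^-1 ^+ r) / (1 + kappa a * y^-1 ^+ r)).
  by apply: vunitM => //; exact: vunitV.
by apply: (mulIf (vunit_neq0 u1)); rewrite e mulrAC divfK ?(vunit_neq0 u1) // mulrC.
Qed.

Section AtInfinity.
Hypothesis mV : vmax O V^-1.

(** The equation gives b y^r + 1 = y^(r-1) (y^r + a) / V, which lies in the maximal ideal. So y is a
    unit with y^r congruent to -1/b, and y^r + a is a unit because ab is not 1. *)
Lemma finite_root_infinity : O y ->
  vunit O y /\ vassoc O (kappa b * y ^+ r + 1) V^-1.
Proof.
move=> Oy.
have e : kappa b * y ^+ r + 1 = y ^+ r.-1 * (y ^+ r + kappa a) * V^-1.
  by rewrite rooty_eq mulrAC divff // mul1r.
have Oyr := subring_setX ringO r Oy.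
have me : vmax O (kappa b * y ^+ r + 1).
  rewrite e; apply: vmaxMl => //; apply: subring_setM => //; first exact: subring_setX.
  exact: subring_setD.
have uy : vunit O y.
  have [//|my] := vunit_or_vmax Oy; exfalso; apply: vunit_vmaxN me.
  by rewrite addrC; apply: vunit1D; apply: vmaxMl => //; exact: vmaxX.
split=> //; exists (y ^+ r.-1 * (y ^+ r + kappa a)) => //.
apply: vunitM => //; first exact: vunitX.
have -> : y ^+ r + kappa a = (kappa b)^-1 * (kappa (a * b - 1) + (kappa b * y ^+ r + 1)).
  have kb0 : kappa b != 0 by rewrite fmorph_eq0.
  by apply: (mulfI kb0); rewrite mulVKf // rmorphB rmorphM rmorph1; ring.
apply: vunitM => //; first by apply: vunitV; exact: vunit_const.
by apply: vunitD1 => //; rewrite subr_eq0.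
Qed.

(** Since (yz)^r - 1 = -(b y^r + 1) has the order of 1/V, only the cofactor of yz - 1 matters; when
    yz is congruent to 1, it is congruent to r and hence a unit. *)
Lemma factor_infinity z : z ^+ r = - b -> O y ->
  vunit O (y * kappa z - 1) \/ vassoc O (y * kappa z - 1) V^-1.
Proof.
move=> zr Oy; have [uy eb] := finite_root_infinity Oy.
have Oyz : O (y * kappa z) by apply: subring_setM.
have Of : O (y * kappa z - 1) by apply: subring_setB => //; exact: subring_set1.
have [uf|mf] := vunit_or_vmax Of; [by left | right].
have := vunit_sum_powers valO (vunit1 valO) vunit_r mf; set s := \sum_(i < r) _ => us.
apply: vassoc_trans eb => //; apply: vassoc_sym => //; exists (- s); first exact: vunitN.
have := subrXX (y * kappa z) 1 r; rewrite -/s exprMn -rmorphXn zr rmorphN expr1n => e.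
by rewrite mulNr [s * _]mulrC -e; ring.
Qed.

Lemma factor_pole z : z != 0 -> ~ O y -> vassoc O (y * kappa z - 1) y.
Proof.
move=> z0 nOy; have mw := vmax_inv valO nOy.
have y0 : y != 0 by apply: contra_notN nOy => /eqP->; exact: subring_set0.
exists (kappa z - y^-1); last by rewrite mulrBl mulVf // mulrC.
by apply: vunitD1 => //; exact: vmaxN.
Qed.

End AtInfinity.

Lemma root_integral : O V -> O y.
Proof.
move=> OV; apply: contrapT => nOy; have [u uu e] := pole_root nOy.
have mw := vmax_inv valO nOy.
have y0 : y != 0 by apply: contra_notN nOy => /eqP->; exact: subring_set0.
apply: (@vunit_vmaxN _ O (y^-1 ^+ r.-1)); last exact: vmaxX.
split; rewrite ?expf_neq0 ?invr_eq0 //; first exact: vmax_mem (vmaxX valO _ mw).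
by rewrite exprVn invrK e; apply: subring_setM => //; exact: vunit_mem.
Qed.

Section AtZero.
Hypothesis mV : vmax O V.

(** Both y^r + a and b y^r + 1 are units when y is small. *)
Lemma small_root : vmax O y -> vassoc O (y ^+ r.-1) V.
Proof.
move=> my; have myr : vmax O (y ^+ r) by exact: vmaxX.
have u1 : vunit O (y ^+ r + kappa a) by rewrite addrC; exact: vunitD1.
have u2 : vunit O (kappa b * y ^+ r + 1) by rewrite addrC; apply: vunit1D; exact: vmaxMl.
exists ((kappa b * y ^+ r + 1) / (y ^+ r + kappa a)).
  by apply: vunitM => //; exact: vunitV.
by apply: (mulIf (vunit_neq0 u1)); rewrite rooty_eq mulrAC divfK ?(vunit_neq0 u1) // mulrC.
Qed.

(** For a unit y the equation makes y^r + a a multiple of V, so y is congruent to some root c of X^r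
    + a. The cofactor of y - c in y^r - c^r is a unit because r is nonzero in k, so y - c itself is
    a multiple of V. *)
Lemma unit_root (cs : seq k) : 'X^r + a%:P = \prod_(c <- cs) ('X - c%:P) ->
  vunit O y -> exists c, [/\ c ^+ r = - a & exists2 w, O w & y - kappa c = w * V].
Proof.
move=> cs_a uy; have Oy := vunit_mem uy.
pose w0 := (kappa b * y ^+ r + 1) / y ^+ r.-1.
have Ow0 : O w0.
  apply: subring_setM => //.
    apply: subring_setD => //; last exact: subring_set1.
    by apply: subring_setM => //; exact: subring_setX.
  exact: vunit_mem (vunitV (vunitX valO _ uy)).
have e : y ^+ r + kappa a = w0 * V.
  have yr0 := vunit_neq0 (vunitX valO r.-1 uy).
  by apply: (mulfI yr0); rewrite rooty_eq mulrA [_ * w0]mulrC divfK // mulrC.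
have me : vmax O (\prod_(c <- cs) (y - kappa c)).
  have : map_poly kappa ('X^r + a%:P) = \prod_(c <- cs) ('X - (kappa c)%:P).
    rewrite cs_a rmorph_prod; apply: eq_bigr => c _.
    by rewrite rmorphB /= map_polyX map_polyC.
  move=> /(congr1 (fun p => p.[y])).
  rewrite rmorphD /= map_polyXn map_polyC horner_prod !hornerE e.
  under eq_bigr => c _ do rewrite !hornerE.
  by move=> <-; apply: vmaxMl.
have [c cs_c mc] : exists2 c, c \in cs & vmax O (y - kappa c).
  apply: contrapT => noc; apply: vunit_vmaxN me; rewrite big_seq.
  apply: big_ind; [exact: vunit1 | by move=> *; exact: vunitM | move=> c cs_c].
  have Oc : O (y - kappa c) by exact: subring_setB.
  by have [//|mc] := vunit_or_vmax Oc; case: noc; exists c.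
have ca : c ^+ r = - a.
  apply/eqP; rewrite -addr_eq0 -[a](hornerC a c) -(hornerXn c r) -hornerD cs_a.
  by rewrite -/(root _ c) root_prod_XsubC.
have c0 : c != 0.
  apply: contraNneq a0 => c0; move: ca; rewrite c0 expr0n gtn_eqF // => /esym/eqP.
  by rewrite oppr_eq0.
exists c; split=> //.
have us := vunit_sum_powers valO (vunit_const c0) vunit_r mc.
exists ((\sum_(i < r) y ^+ (r.-1 - i) * kappa c ^+ i)^-1 * w0).
  by apply: subring_setM => //; exact: vunit_mem (vunitV us).
apply: (mulIf (vunit_neq0 us)); rewrite -subrXX -[_ * w0 * V]mulrA -e.
rewrite [RHS]mulrC mulVKf ?(vunit_neq0 us) // -[a]opprK -ca.
by rewrite rmorphN rmorphXn.
Qed.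

End AtZero.
End OneRoot.

Section AllRoots.
Variables (n : nat) (y : 'I_n -> L).
Hypothesis psi_y : psi r (kappa a) (kappa b) V = \prod_i ('X - (y i)%:P).

Lemma root_psi i : root (psi r (kappa a) (kappa b) V) (y i).
Proof. by rewrite psi_y /root horner_prod (bigD1 i) //= hornerXsubC subrr mul0r. Qed.

(** The value of psi at 0 is -V. *)
Lemma prod_roots : vassoc O (\prod_i y i) V.
Proof.
have := congr1 (fun p => p.[0]) psi_y.
rewrite horner_psi horner_prod !expr0n !gtn_eqF // !(mul0r, mulr0, add0r, mulr1).
under eq_bigr => i _ do rewrite hornerXsubC sub0r -mulN1r.
rewrite big_split prodr_const /= => e.
have uX : vunit O ((-1) ^+ #|'I_n| : L).
  by apply: vunitX => //; apply: vunitN => //; exact: vunit1.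
apply: vassoc_sym => //; exists (- (-1) ^+ #|'I_n|); first exact: vunitN.
by rewrite mulNr -e opprK.
Qed.

(** The (r-1)-st power of [prod_roots] compares V^|P| with V^(r-1). This counts the small roots at V
    = 0 and the poles at V = infinity. *)
Lemma card_special_roots (P : pred 'I_n) : vmax O V \/ vmax O V^-1 ->
  (forall i, P i -> vassoc O (y i ^+ r.-1) V) -> (forall i, ~~ P i -> vunit O (y i)) ->
  #|P| = r.-1.
Proof.
move=> mV Py nPy.
have : vassoc O (\prod_(i | P i) V * \prod_(i | ~~ P i) 1) (V ^+ r.-1).
  apply: vassoc_trans (vassocX valO r.-1 prod_roots) => //.
  rewrite -prodrXl [X in vassoc _ _ X](bigID P) /=; apply: vassoc_sym => //.
  apply: vassocM => //; apply: vassoc_prod => // i nPi.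
  by apply: vassoc_unit; apply: vunitX => //; exact: nPy.
rewrite big1_eq mulr1 prodr_const => VV.
case: mV => mV; first exact: (vassoc_exp_inj valO mV V0 VV).
apply: (vassoc_exp_inj valO mV); first by rewrite invr_eq0.
by rewrite !exprVn; exact: vassocV.
Qed.

End AllRoots.
End Roots.

(** * Poles of the relation and blocks of imprimitivity *)

Lemma sum_mem_card (T : finType) (A : {set T}) : (\sum_i (i \in A : nat))%N = #|A|.
Proof. by rewrite -sum1_card [RHS]big_mkcond /=; apply: eq_bigr => i _; case: ifP. Qed.

(* Compare valuations in the relation: a pole of y contributes -1/(r-1), and a
   point where [y * kappa z = 1] contributes +1. *)
Lemma poles_of_relation (k L : fieldType) (kappa : {rmorphism k -> L}) (O : set L)
    (V : L) (r : nat) (a b beta : k) (n : nat) (y : 'I_n -> L) (z : 'I_n -> k) :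
  valuation_ring O -> (forall c, O (kappa c)) ->
  (1 < r)%N -> r%:R != 0 :> k -> b != 0 -> a * b != 1 -> V != 0 ->
  vmax O V^-1 ->
  psi r (kappa a) (kappa b) V = \prod_i ('X - (y i)%:P) ->
  (forall i, z i = 0 \/ z i ^+ r = - b) ->
  #|[set i | z i == 0]| = r.-1 ->
  beta != 0 -> \prod_i (y i * kappa (z i) - 1) = kappa beta ->
  let Z := [set i | ~~ `[< O (y i) >]] in
  #|Z| = r.-1 /\ (Z = [set i | z i == 0] \/ [disjoint Z & [set i | z i == 0]]).
Proof.
move=> valO Ok r1 r0 b0 ab1 V0 mV psi_y zP cardz beta0 rel.
set T := [set i | z i == 0]; set Z := [set i | _] => /=.
have ZP i : reflect (~ O (y i)) (i \in Z) by rewrite /Z inE; exact: asboolPn.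
have W0 : V^-1 != 0 by rewrite invr_eq0.
have rooty i := root_psi psi_y i.
have cardZ : #|Z| = r.-1.
  apply: (card_special_roots (kappa := kappa) valO r1 V0 psi_y); first by right.
    by move=> i /ZP; exact: (pole_root valO Ok r1 b0 (rooty i)).
  move=> i /negP nZ; have Oy : O (y i) by apply: contrapT => /ZP.
  by have [] := finite_root_infinity valO Ok r1 b0 ab1 V0 (rooty i) mV Oy.
split=> //.
(* [M] collects the indices with y_i z_i congruent to 1, where the factor vanishes to order 1. *)
pose M := [set i | [&& i \notin Z, i \notin T & ~~ `[< vunit O (y i * kappa (z i) - 1) >]]].
have ME i : (i \in M) = [&& i \notin Z, i \notin T
    & ~~ `[< vunit O (y i * kappa (z i) - 1) >]] by rewrite /M inE.
(* The power r-1 makes the order at a pole an integer, so that all factors compare with powers of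
   V. *)
have fP i : vassoc O ((y i * kappa (z i) - 1) ^+ r.-1)
    (V ^+ (i \in Z :\: T) * V^-1 ^+ (r.-1 * (i \in M))).
  have [iT|iT] := boolP (i \in T).
    rewrite finset.in_setD ME iT /= andbF muln0 !expr0 mul1r.
    move: iT; rewrite inE => /eqP ->; rewrite rmorph0 mulr0 sub0r.
    apply: vassoc_unit; apply: vunitX => //; apply: vunitN => //; exact: vunit1.
  have zi0 : z i != 0 by move: iT; rewrite inE.
  rewrite finset.in_setD iT /=.
  have [iZ|iZ] := boolP (i \in Z).
    rewrite ME iZ /= muln0 expr0 mulr1 expr1.
    have nOy := elimT (ZP i) iZ.
    apply: vassoc_trans (pole_root valO Ok r1 b0 (rooty i) nOy) => //.
    by apply: vassocX => //; exact: (factor_pole valO Ok).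
  rewrite expr0 mul1r ME iZ iT /=.
  have Oy : O (y i) by apply: contrapT => /ZP; exact/negP.
  have zr : z i ^+ r = - b by have [zi|//] := zP i; move: zi0; rewrite zi eqxx.
  have [uf|nuf] := pselect (vunit O (y i * kappa (z i) - 1)).
    by rewrite asboolT //= muln0 expr0; apply: vassoc_unit; apply: vunitX.
  rewrite asboolF //= muln1; apply: vassocX => //.
  by have [//|] := factor_infinity valO Ok r1 r0 b0 ab1 V0 (rooty i) mV zr Oy.
have : vassoc O (V^-1 ^+ (r.-1 * #|M|)) (V^-1 ^+ #|Z :\: T|).
  have u1 : vunit O (kappa beta ^+ r.-1) by apply: vunitX => //; exact: (vunit_const Ok).
  rewrite -rel -prodrXl in u1.
  have := @vassoc_prod _ _ valO _ (index_enum 'I_n) xpredT _ _ (fun i _ => fP i).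
  rewrite big_split /= -!expr_sum -big_distrr /= !sum_mem_card.
  set p := \prod_(i | _) _ in u1 *; move=> [u uu pE].
  exists (u^-1 * p); first by apply: vunitM => //; exact: vunitV.
  rewrite pE mulKf ?(vunit_neq0 uu) // mulrAC -exprMn.
  by rewrite divff // expr1n mul1r.
move=> /(vassoc_exp_inj valO mV W0) cE.
(* By [cE], (r-1) |M| equals the size of Z minus T, which is at most |Z| = r-1. So Z minus T is
   empty or all of Z. *)
have sub : Z :\: T \subset Z by exact: subsetDl.
have := subset_leq_card sub; rewrite -cE cardZ.
case: #|M| cE => [|m] cE le_m.
  left; apply/eqP; rewrite eqEcard cardZ cardz leqnn andbT -finset.setD_eq0 -cards_eq0 -cE muln0 //.
right; have : Z :\: T == Z by rewrite eqEcard sub cardZ -cE mulnS leq_addr.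
by move/eqP/finset.setDidPl.
Qed.

(* The hypothesis on [G] makes [T] a block of imprimitivity of a transitive
   group, so its size r-1 would have to divide 2r-1. *)
Lemma no_block (r n : nat) (G : {set {perm 'I_n}}) (Z T : {set 'I_n}) :
  (2 < r)%N -> n = (r.-1 + r)%N ->
  (forall g h, g \in G -> h \in G -> (g * h)%g \in G) ->
  (forall i j, exists2 g, g \in G & g i = j) ->
  #|Z| = r.-1 -> #|T| = r.-1 ->
  (forall g : {perm 'I_n}, g \in G ->
     let Zg := [set i | g i \in Z] in Zg = T \/ [disjoint Zg & T]) ->
  False.
Proof.
move=> r2 nE GM Gtrans cardZ cardT dich.
(* The classes of [e] are the candidate blocks: every g in [G] sends a class entirely into [Z] or
   entirely outside it. *)
pose e := [rel i l | [forall g : {perm 'I_n}, (g \in G) ==> ((g i \in Z) == (g l \in Z))]].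
have eP i l : reflect (forall g : {perm 'I_n}, g \in G -> (g i \in Z) = (g l \in Z)) (e i l).
  apply: (iffP forallP) => [H g gG|H g]; first by apply/eqP; apply: (implyP (H g)).
  by apply/implyP => gG; rewrite H.
pose C i := [set l | e i l].
have eqe : {in [set: 'I_n] & &, equivalence_rel e}.
  move=> i j l _ _ _; split; first exact/eP.
  by move=> /eP eij; apply/eP/eP => H g gG; rewrite -H // eij.
(* If g sends one element of [T] into [Z], the preimage of [Z] under g meets [T] and therefore
   equals [T]. Hence [T] is a single class. *)
have CE i : i \in T -> C i = T.
  move=> iT; have [z zZ] : exists z, z \in Z by apply/card_gt0P; rewrite cardZ; lia.
  have [g0 g0G g0i] := Gtrans i z.
  have inT g l : g \in G -> l \in T -> ([set i | g i \in Z] = T) <-> (g l \in Z).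
    move=> gG lT; split=> [ZT|glZ]; first by move: lT; rewrite -ZT inE.
    have [//|H] := dich g gG.
    by have := disjointFr H (x := l); rewrite inE lT => /(_ glZ).
  apply/setP => l; apply/idP/idP => [|lT].
    rewrite inE => /eP/(_ _ g0G); rewrite g0i zZ => /esym.
    have /= <- : [set i | g0 i \in Z] = T by apply/(inT _ i) => //; rewrite g0i.
    by rewrite inE.
  rewrite inE; apply/eP => g gG.
  by apply/idP/idP => [gi|gl]; apply/(inT g) => //; [apply/(inT g i) | apply/(inT g l)].
(* Closure under products makes [G] map classes into classes, and transitivity then gives them all
   the same size. *)
have leC i j : (#|C i| <= #|C j|)%N.
  have [h hG <-] := Gtrans i j.
  rewrite -(card_imset (C i) (@perm_inj _ h)); apply: subset_leq_card.
  apply/fintype.subsetP => x /imsetP[l + ->]; rewrite !inE => /eP il.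
  by apply/eP => g gG; rewrite -!permM; apply: il; exact: GM.
have [i0 i0T] : exists i, i \in T by apply/card_gt0P; rewrite cardT; lia.
have cardC i : #|C i| = r.-1.
  by rewrite -cardT -(CE _ i0T); apply/eqP; rewrite eqn_leq !leC.
pose Q := equivalence_partition e [set: 'I_n].
have Qcard : {in Q, forall A : {set 'I_n}, #|A| = r.-1}.
  move=> A /imsetP[i _ ->]; rewrite -(cardC i); apply: eq_card => l.
  by rewrite !inE.
have := card_uniform_partition Qcard (equivalence_partitionP eqe).
rewrite cardsT card_ord; move: #|Q| => m; rewrite [in n = _]nE.
(* The partition gives 2r - 1 = m (r-1). Two classes are too few, and three already exceed 2r - 1
   because r > 2. *)
case: m => [|[|[|m]]]; nia.
Qed.

(** * Valuations of a field containing k[V] *)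

Section FunctionField.
Variables (k L : fieldType) (iota : {rmorphism {poly k} -> L}).
Hypothesis iota_eq0 : forall p, iota p = 0 -> p = 0.

Let kappa : {rmorphism k -> L} := iota \o polyC.
Let V := iota 'X.

Let V0 : V != 0.
Proof. by apply/eqP => /iota_eq0/eqP; rewrite polyX_eq0. Qed.

Lemma function_field_hornerE (p : {poly k}) : iota p = (map_poly kappa p).[V].
Proof.
rewrite -{1}[p]coefK poly_def rmorph_sum horner_coef size_map_poly /=.
apply: eq_bigr => i _.
by rewrite -mul_polyC rmorphM rmorphXn coef_map.
Qed.

Lemma subring_range : subring_set (fun x => exists p, x = iota p).
Proof.
split; first by exists 1; rewrite rmorph1.
  by move=> _ _ [p ->] [q ->]; exists (p - q); rewrite rmorphB.
by move=> _ _ [p ->] [q ->]; exists (p * q); rewrite rmorphM.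
Qed.

(** A nonconstant p is not invertible in k[V], so Chevalley's theorem applies. The choice p = X
    gives the place V = 0; other choices detect denominators. *)
Lemma valuation_over_poly (p : {poly k}) : (1 < size p)%N ->
  exists O, [/\ valuation_ring O, forall q, O (iota q) & vmax O (iota p)].
Proof.
move=> p1; have p0 : iota p != 0.
  by apply/eqP => /iota_eq0 p0; rewrite p0 size_poly0 in p1.
have [|||O [valO sub nO]] := @chevalley_extension L (fun x => exists p, x = iota p) (iota p).
- exact: subring_range.
- by exists p.
- move=> [q e]; have : iota (p * q - 1) = 0 by rewrite rmorphB rmorphM rmorph1 -e divff // subrr.
  move=> /iota_eq0/eqP; rewrite subr_eq0 => /eqP pq1.
  have : size (p * q) = 1%N by rewrite pq1 size_poly1.
  have q0 : q != 0 by apply: contraPneq pq1 => ->; rewrite mulr0 => /esym/eqP; rewrite oner_eq0.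
  have pn0 : p != 0 by apply: contraNneq p0 => ->; rewrite rmorph0.
  rewrite size_mul //; move: q0 p1; rewrite -size_poly_gt0.
  by case: (size q) => [|m] //; case: (size p) => [|[|l]]; lia.
have Oi q : O (iota q) by apply: sub; exists q.
by exists O; split => //; exact: vmaxP.
Qed.

Lemma valuation_infinity :
  exists O, [/\ valuation_ring O, forall c, O (kappa c) & vmax O V^-1].
Proof.
pose A x := exists p : {poly k}, x = (map_poly kappa p).[V^-1].
have [|||O [valO sub nO]] := @chevalley_extension L A V^-1.
- split; first by exists 1; rewrite rmorph1 hornerE.
    by move=> _ _ [p ->] [q ->]; exists (p - q); rewrite rmorphB !hornerE.
  by move=> _ _ [p ->] [q ->]; exists (p * q); rewrite rmorphM hornerM.
- by exists 'X; rewrite map_polyX hornerX.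
- rewrite invrK => -[p e].
  (* [s] is X^(size p) p(1/X). The equation V = p(1/V) would give X^(size p + 1) = [s], whose degree
     is at most size p. *)
  pose s := \sum_(i < size p) p`_i *: 'X^(size p - i) : {poly k}.
  have : iota ('X^((size p).+1) - s) = 0.
    rewrite rmorphB rmorphXn rmorph_sum -/V exprSr {2}e horner_coef size_map_poly mulr_sumr.
    apply/eqP; rewrite subr_eq0; apply/eqP; apply: eq_bigr => i _.
    rewrite -mul_polyC rmorphM rmorphXn coef_map -/V /= mulrCA exprVn; congr (_ * _).
    by rewrite -expfB.
  move=> /iota_eq0/eqP; rewrite subr_eq0 => /eqP/(congr1 (fun q : {poly k} => size q)).
  rewrite size_polyXn => e2.
  have : (size s <= (size p).+1)%N.
    apply: (leq_trans (size_sum _ _ _)); apply/bigmax_leqP => i _.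
    by apply: (leq_trans (size_scale_leq _ _)); rewrite size_polyXn ltnS leq_subr.
  by rewrite -e2 ltnn.
have Ok c : O (kappa c) by apply: sub; exists c%:P; rewrite map_polyC hornerC.
exists O; split=> //; apply: vmaxP => //; last by rewrite invr_eq0.
by apply: sub; exists 'X; rewrite map_polyX hornerX.
Qed.

(** Here i is the multiplicity of the root 0; the cofactor is a nonzero constant plus a multiple of
    V, hence a unit. *)
Lemma vassoc_poly_zero O (p : {poly k}) : valuation_ring O -> (forall c, O (kappa c)) -> vmax O V ->
  p != 0 -> exists2 i, (i < size p)%N & vassoc O (iota p) (V ^+ i).
Proof.
move=> valO Ok mV p0; have [i [q]] := multiplicity_XsubC p 0.
rewrite p0 subr0 /= => q0 pE.
have q_neq0 : q != 0 by apply: contraNneq p0 => q00; rewrite pE q00 mul0r.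
exists i.
  by rewrite pE size_mulXn // -addn1 leq_add2l size_poly_gt0.
exists (iota q); last by rewrite pE rmorphM rmorphXn.
have ringO := valO.1.
have -> : q = q.[0]%:P + (q - q.[0]%:P) by rewrite addrC subrK.
have /factor_theorem[s ->] : root (q - q.[0]%:P) 0 by rewrite /root !hornerE subrr.
rewrite subr0 rmorphD rmorphM; apply: vunitDr => //.
  exact: (vunit_const (kappa := kappa)).
apply: vmaxMl => //; rewrite function_field_hornerE horner_coef.
apply: subring_set_sum => // j _; rewrite coef_map.
apply: (subring_setM ringO); first exact: Ok.
exact: (subring_setX ringO _ (vmax_mem mV)).
Qed.

Lemma vassoc_poly_infinity O (p : {poly k}) : valuation_ring O -> (forall c, O (kappa c)) ->
  vmax O V^-1 -> p != 0 -> vassoc O (iota p) (V ^+ (size p).-1).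
Proof.
move=> valO Ok mV p0; have sp : size p = (size p).-1.+1 by rewrite prednK // size_poly_gt0.
rewrite function_field_hornerE horner_coef size_map_poly sp big_ord_recr /=.
set d := (size p).-1 in sp *.
exists (\sum_(i < d) kappa p`_i * V^-1 ^+ (d - i) + kappa p`_d).
  rewrite addrC; apply: vunitDr => //.
    by apply: (vunit_const Ok); rewrite -lead_coefE lead_coef_eq0.
  by apply: vmax_sum => // i _; apply: vmaxMl => //; apply: vmaxX => //; rewrite subn_gt0.
rewrite mulrDl mulr_suml coef_map; congr (_ + _); apply: eq_bigr => i _.
rewrite coef_map -mulrA; congr (_ * _).
have le_id : (i <= d)%N by exact: ltnW.
have -> : V ^+ d = V ^+ (d - i) * V ^+ i by rewrite -exprD subnK.
by rewrite mulrA exprVn mulVf ?mul1r // expf_neq0.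
Qed.

End FunctionField.

(** * Fractions and common denominators *)

Section Fractions.
Local Open Scope quotient_scope.

Lemma fraction_numden (R : idomainType) (c : {fraction R}) :
  exists n m : R, m != 0 /\ c = tofrac n / tofrac m.
Proof.
suff [n [m [m0 e]]] : exists n m : R, m != 0 /\ c * tofrac m = tofrac n.
  by exists n, m; split=> //; rewrite -e mulfK // tofrac_eq0.
elim/quotW: c => x; exists (\n_x), (\d_x); split; first exact: denom_ratioP.
unlock FracField.tofrac; rewrite -[LHS]FracField.pi_mul; apply/eqmodP.
rewrite /= FracField.equivfE /FracField.mulf !numden_Ratio ?mulf_neq0 ?oner_neq0 ?denom_ratioP //.
by rewrite !mulr1 mulrC.
Qed.

End Fractions.

Lemma clear_denominators (R : idomainType) (D : {poly {fraction R}}) :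
  exists d (E : {poly R}), d != 0 /\ (tofrac d) *: D = map_poly (@tofrac R) E.
Proof.
elim/poly_ind: D => [|D c [d [E [d0 DE]]]].
  by exists 1, 0; rewrite oner_neq0 scaler0 rmorph0.
have [n [m [m0 ->]]] := fraction_numden c.
exists (d * m), (m%:P * (E * 'X) + (d * n)%:P).
split; first by rewrite mulf_neq0.
rewrite rmorphD !rmorphM /= map_polyX !map_polyC /= -DE -!mul_polyC !rmorphM /=.
have mV : (tofrac m)%:P * (tofrac m)^-1%:P = 1 :> {poly {fraction R}}.
  by rewrite -polyCM divff // tofrac_eq0.
move: mV; move: (tofrac m)%:P ((tofrac m)^-1%:P) (tofrac n)%:P (tofrac d)%:P => M M' N' D' mV.
transitivity (D' * (M * (D * 'X)) + D' * N' * (M * M')); first by ring.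
by rewrite mV; ring.
Qed.

(** * Transcendence, simplicity and conjugacy of the roots *)

Section RootField.
Variables (k L : fieldType) (iota : {rmorphism {poly k} -> L}).
Hypothesis iota_eq0 : forall p, iota p = 0 -> p = 0.
Variables (r : nat) (a b : k).
Hypotheses (r_gt1 : (1 < r)%N).
Hypotheses (a0 : a != 0) (ab1 : a * b != 1).

Let kappa : {rmorphism k -> L} := iota \o polyC.
Let V := iota 'X.
Let num : {poly k} := 'X^(r.-1) * ('X^r + a%:P).
Let den : {poly k} := b%:P * 'X^r + 1.
Let ev (y : L) (p : {poly k}) := (map_poly kappa p).[y].

Let r_gt0 : (0 < r)%N. Proof. exact: ltnW. Qed.

Let r1_gt0 : (0 < r.-1)%N. Proof. by rewrite -ltnS prednK. Qed.

Let psiE : psi r (kappa a) (kappa b) V = map_poly kappa num - V%:P * map_poly kappa den.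
Proof.
rewrite /psi /num /den rmorphM !rmorphD rmorphM /= !map_polyXn.
by rewrite (map_polyC _ a) (map_polyC _ b) rmorph1.
Qed.

Section OneRoot.
Variable y : L.
Hypothesis rooty : root (psi r (kappa a) (kappa b) V) y.

Let num_den : ev y num = V * ev y den.
Proof.
by move: rooty; rewrite psiE /root !hornerE subr_eq0 => /eqP.
Qed.

(** A zero of B at y would also be a zero of A, but A and B have no common zero because ab is not
    1. *)
Lemma den_root_neq0 : ev y den != 0.
Proof.
apply/eqP => den0; have := num_den; rewrite den0 mulr0 => /eqP.
have denE : ev y den = kappa b * y ^+ r + 1.
  by rewrite /ev /den rmorphD rmorphM /= map_polyXn map_polyC rmorph1 !hornerE.
have numE : ev y num = y ^+ r.-1 * (y ^+ r + kappa a).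
  by rewrite /ev /num rmorphM rmorphD /= !map_polyXn map_polyC !hornerE.
move: den0; rewrite denE numE mulf_eq0 expf_eq0 r1_gt0 /= => den0 /orP[/eqP y0|].
  by move: den0; rewrite y0 expr0n gtn_eqF // mulr0 add0r => /eqP; rewrite oner_eq0.
rewrite addr_eq0 => /eqP yr; move: den0; rewrite yr => e.
have : kappa (a * b - 1) = - (kappa b * - kappa a + 1).
  by rewrite rmorphB rmorphM rmorph1; ring.
by rewrite e oppr0 => /eqP; rewrite fmorph_eq0 subr_eq0 (negPf ab1).
Qed.

(** If y were algebraic over k, so would be V = A(y)/B(y). *)
Lemma root_transcendental (p : {poly k}) : ev y p = 0 -> p = 0.
Proof.
move=> py0; apply/eqP; apply: contraT => p0.
have alg_y : algebraicOver kappa y by exists p => //; apply/eqP.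
have alg_ev q : algebraicOver kappa (ev y q).
  rewrite /ev horner_coef; apply: big_ind => [||i _]; first exact: algebraic0.
    exact: algebraic_add.
  rewrite coef_map; apply: algebraic_mul; first exact: algebraic_id.
  elim: (i : nat) => [|j IH]; first exact: algebraic1.
  by rewrite exprS; exact: algebraic_mul.
have [q q0] : algebraicOver kappa V.
  have -> : V = ev y num / ev y den by rewrite num_den mulfK // den_root_neq0.
  exact: algebraic_div.
rewrite /root -(function_field_hornerE iota) => /eqP/iota_eq0/eqP.
by rewrite (negPf q0).
Qed.

(** At a multiple root y the Wronskian A'B - AB' vanishes, and since y is transcendental it is zero
    identically. Its coefficient a (r-1) of X^(r-2) forces r = 1 in k, and then the coefficient 2r -
    1 - ab of X^(2r-2) is 1 - ab, which is nonzero. *)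
Lemma deriv_psi_root : (psi r (kappa a) (kappa b) V)^`().[y] != 0.
Proof.
apply/eqP => d0; pose w := num^`() * den - num * den^`().
have w0 : w = 0.
  apply: root_transcendental; move: d0; rewrite psiE derivB derivM derivC mul0r add0r.
  rewrite !deriv_map !hornerE => e.
  rewrite /ev rmorphB (rmorphM _ num^`()) (rmorphM _ num) hornerD hornerN !hornerM.
  rewrite -!/(ev y _) num_den /ev.
  by rewrite mulrAC -mulrBl e mul0r.
have wE : w = (b * r.-1%:R) *: 'X^(r + r.-1 + r.-1)
    + ((r + r.-1)%:R - a * b) *: 'X^(r.-1 + r.-1) + (a * r.-1%:R) *: 'X^(r.-2).
  rewrite /w /num /den; case: r r_gt1 => [|[|s]] // _ /=.
  have dX n : ('X^(n.+1))^`() = (n.+1%:R)%:P * 'X^n :> {poly k}.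
    by rewrite derivXn mul_polyC scaler_nat.
  have -> : ('X^(s.+1) * ('X^(s.+2) + a%:P))^`() = (s.+1%:R)%:P * 'X^s * ('X^(s.+2) + a%:P)
      + 'X^(s.+1) * ((s.+2%:R)%:P * 'X^(s.+1)) :> {poly k}.
    by rewrite derivM derivD derivC addr0 !dX.
  have -> : (b%:P * 'X^(s.+2) + 1)^`() = b%:P * ((s.+2%:R)%:P * 'X^(s.+1)) :> {poly k}.
    by rewrite derivD derivM -polyC1 !derivC mul0r add0r addr0 dX.
  rewrite natrD -!natr1; move: (s%:R) => S.
  rewrite -!mul_polyC !(polyCD, polyCN, polyCM).
  have -> : 'X^(s.+1) = 'X * 'X^s :> {poly k} by rewrite exprS.
  have -> : 'X^(s.+2) = 'X * ('X * 'X^s) :> {poly k} by rewrite !exprS.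
  have -> : 'X^(s.+2 + s.+1 + s.+1) = 'X ^+ 4 * 'X^s * 'X^s * 'X^s :> {poly k}.
    by rewrite -!exprD; congr ('X^_); lia.
  have -> : 'X^(s.+1 + s.+1) = 'X ^+ 2 * 'X^s * 'X^s :> {poly k}.
    by rewrite -!exprD; congr ('X^_); lia.
  by move: ('X^s) => T; ring.
have wi i : w`_i = 0 by rewrite w0 coef0.
have r1k : r.-1%:R = 0 :> k.
  have := wi r.-2; rewrite wE !coefD !coefZ !coefXn eqxx mulr1.
  rewrite ltn_eqF ?mulr0; last by lia.
  rewrite ltn_eqF ?mulr0 ?add0r; last by lia.
  by move=> /eqP; rewrite mulf_eq0 (negPf a0) => /eqP.
have := wi (r.-1 + r.-1)%N; rewrite wE !coefD !coefZ !coefXn eqxx mulr1.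
rewrite ltn_eqF ?mulr0 ?add0r; last by lia.
rewrite gtn_eqF ?mulr0 ?addr0; last by lia.
rewrite natrD r1k addr0 -(prednK r_gt0) -natr1 r1k add0r => /eqP.
by rewrite subr_eq0 eq_sym (negPf ab1).
Qed.

End OneRoot.

(* A root y is transcendental over k and V is the same rational function
   of every root, so an identity D(V, y) = 0 holds for all roots at once. *)
Lemma root_conjugate (D : {poly {poly k}}) (y1 y2 : L) :
  root (psi r (kappa a) (kappa b) V) y1 -> root (psi r (kappa a) (kappa b) V) y2 ->
  root (map_poly iota D) y1 -> root (map_poly iota D) y2.
Proof.
move=> ry1 ry2 Dy1; pose N := (\max_(j < size D) size (D`_j)%R)%N.
(* [P] is D(V, X) with A/B substituted for V, multiplied by B^N to clear denominators. *)
pose P : {poly k} := \sum_(j < size D)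
  (\sum_(l < size D`_j) D`_j`_l *: (num ^+ l * den ^+ (N - l))) * 'X^j.
have PE y : root (psi r (kappa a) (kappa b) V) y ->
    ev y P = ev y den ^+ N * (map_poly iota D).[y].
  move=> ry; have num_den : ev y num = V * ev y den.
    by move: ry; rewrite psiE /root !hornerE subr_eq0 => /eqP.
  have sD : size (map_poly iota D) = size D.
    apply: size_map_inj_poly; last exact: rmorph0.
    by move=> p q e; apply: subr0_eq; apply: iota_eq0; rewrite rmorphB e subrr.
  rewrite /ev /P rmorph_sum horner_sum [in RHS](horner_coef (map_poly iota D)) sD.
  rewrite mulr_sumr; apply: eq_bigr => j _.
  rewrite rmorphM /= map_polyXn hornerM hornerXn coef_map mulrA; congr (_ * _).
  transitivity (ev y den ^+ N * (map_poly kappa D`_j).[V]); last first.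
    by congr (_ * _); rewrite -(function_field_hornerE iota).
  rewrite rmorph_sum horner_sum [in RHS]horner_coef size_map_poly.
  rewrite mulr_sumr; apply: eq_bigr => l _.
  have le_lN : (l <= N)%N.
    by apply: (leq_trans (ltnW (ltn_ord l))); rewrite /N (bigD1 j) //= leq_maxl.
  rewrite -mul_polyC (rmorphM _ (_)%:P) (rmorphM _ (num ^+ l)) !rmorphXn /= map_polyC coef_map.
  rewrite hornerM hornerC hornerM !horner_exp -!/(ev y _) num_den.
  have -> : ev y den ^+ N = ev y den ^+ (N - l) * ev y den ^+ l by rewrite -exprD subnK.
  rewrite exprMn [RHS]mulrCA; congr (_ * _).
  by rewrite mulrC [V ^+ l * _]mulrC mulrA.
have P0 : P = 0.
  by apply: (root_transcendental ry1); rewrite PE // (eqP Dy1) mulr0.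
have := PE _ ry2; rewrite P0 /ev rmorph0 horner0 => /esym/eqP.
by rewrite mulf_eq0 expf_eq0 (negPf (den_root_neq0 ry2)) andbF.
Qed.

End RootField.

(** * Galois action on the roots *)

Lemma map_psi (R S : comNzRingType) (f : {rmorphism R -> S}) r (a b V : R) :
  map_poly f (psi r a b V) = psi r (f a) (f b) (f V).
Proof.
rewrite /psi rmorphB !rmorphM !rmorphD rmorphM /= !map_polyXn.
by rewrite (map_polyC _ a) (map_polyC _ b) (map_polyC _ V) rmorph1.
Qed.

Lemma psi_monic (F : fieldType) r (a b V : F) : (1 < r)%N ->
  psi r a b V \is monic /\ size (psi r a b V) = (r.-1 + r).+1.
Proof.
move=> r1; have r0 : (0 < r)%N by exact: ltnW.
have mD : 'X^(r.-1) * ('X^r + a%:P) \is monic.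
  by rewrite monicMl ?monicXn // monicXnaddC.
have sD : size ('X^(r.-1) * ('X^r + a%:P)) = (r.-1 + r).+1.
  by rewrite mulrC size_mulXn ?size_XnaddC ?addnS ?monic_neq0 ?monicXnaddC.
have sB : (size (- (V%:P * (b%:P * 'X^r + 1))) <= r.+1)%N.
  rewrite size_polyN mul_polyC (leq_trans (size_scale_leq _ _)) //.
  rewrite (leq_trans (size_polyD _ _)) // geq_max size_poly1 ltnS mul_polyC.
  by rewrite (leq_trans (size_scale_leq _ _)) ?size_polyXn.
have lt : (size (- (V%:P * (b%:P * 'X^r + 1)))%R < size ('X^(r.-1) * ('X^r + a%:P))%R)%N.
  by rewrite sD (leq_ltn_trans sB) //; lia.
by rewrite /psi monicE lead_coefDl // size_polyDl // sD (monicP mD).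
Qed.

Section Galois.
Variables (k : fieldType) (L : splittingFieldType {fraction {poly k}}).
Variables (r : nat) (a b : k).
Hypotheses (r_gt1 : (1 < r)%N) (a0 : a != 0) (b0 : b != 0) (ab1 : a * b != 1).

Let iota : {rmorphism {poly k} -> L} := in_alg L \o @tofrac {poly k}.
Let kappa : {rmorphism k -> L} := iota \o polyC.
Let V := iota 'X.
Let Psi : {poly L} := psi r (kappa a) (kappa b) V.

Lemma iota_inj0 (p : {poly k}) : iota p = 0 -> p = 0.
Proof. by move/eqP; rewrite fmorph_eq0 tofrac_eq0 => /eqP. Qed.

Lemma gal_iota (g : gal_of {:L}) (p : {poly k}) : g (iota p) = iota p.
Proof. exact: (rmorph_alg g). Qed.

Hypothesis splitL : splittingFieldFor 1 Psi {:L}.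

Lemma Psi_over : Psi \is a polyOver 1%VS.
Proof.
have -> : Psi = map_poly (in_alg L) (psi r (tofrac a%:P) (tofrac b%:P) (tofrac 'X)).
  by rewrite map_psi.
exact: alg_polyOver.
Qed.

(** A common root of [Psi] and its derivative is excluded by [deriv_psi_root], so [Psi] is separable
    and its splitting field is Galois. *)
Lemma exists_roots : exists y : 'I_(r.-1 + r) -> L,
  [/\ Psi = \prod_i ('X - (y i)%:P), injective y & galois 1 {:L}].
Proof.
have [mon sz] := psi_monic (kappa a) (kappa b) V r_gt1.
have [rs /= Drs defL] := splitL.
have PsiE : Psi = \prod_(x <- rs) ('X - x%:P).
  by apply/eqP; rewrite -eqp_monic ?monic_prod_XsubC.
have rs_root x : x \in rs -> root Psi x by rewrite PsiE root_prod_XsubC.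
have srs : size rs = (r.-1 + r)%N.
  by have := sz; rewrite -/Psi PsiE size_prod_XsubC => -[].
have sepP : separable_poly Psi.
  rewrite unlock; set g := gcdp Psi Psi^`().
  have /dvdp_prod_XsubC[m gm] : g %| \prod_(x <- rs) ('X - x%:P).
    by rewrite -PsiE dvdp_gcdl.
  rewrite -gcdp_eqp1 -/g.
  case em : (mask m rs) gm => [|x s] gm; first by rewrite big_nil in gm.
  exfalso; have gx : root g x by rewrite (eqp_root gm) root_prod_XsubC mem_head.
  have xrs : x \in rs by apply: (mem_mask (m := m)); rewrite em mem_head.
  have := deriv_psi_root iota_inj0 r_gt1 a0 ab1 (rs_root _ xrs).
  by move: gx; rewrite root_gcd => /andP[_ /eqP ->]; rewrite eqxx.
have urs : uniq rs by rewrite -separable_prod_XsubC -PsiE.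
exists (fun i => rs`_i); split.
- by rewrite PsiE (big_nth 0) srs big_mkord.
- by move=> i j /eqP; rewrite nth_uniq ?srs ?ltn_ord // => /eqP /val_inj.
- by apply/splitting_galoisField; exists Psi; rewrite Psi_over.
Qed.

(** After clearing denominators, [root_conjugate] makes y a root of the minimal polynomial of x;
    normality then supplies g. *)
Lemma galois_transitive x y : root Psi x -> root Psi y -> normalField 1 {:L} ->
  exists2 g : gal_of {:L}, g \in 'Gal({:L} / 1)%g & g x = y.
Proof.
move=> rx ry nor; apply: normalField_root_minPoly; rewrite ?subvf ?memvf //.
have /polyOver1P[D DE] := minPolyOver 1 x.
have [d [E [d0 dE]]] := clear_denominators D.
have EE : map_poly iota E = (in_alg L (tofrac d)) *: minPoly 1 x.
  by rewrite DE -map_polyZ dE -map_poly_comp.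
have tz : in_alg L (tofrac d) != 0 by rewrite fmorph_eq0 tofrac_eq0.
rewrite -(rootZ _ _ tz) -EE; apply: (root_conjugate iota_inj0 r_gt1 ab1 rx ry).
by rewrite EE rootZ // root_minPoly.
Qed.

End Galois.

(** * The multiplicative relation between the roots *)

Section ApproximateRelation.
Variables (k L : fieldType) (kappa : {rmorphism k -> L}) (O : set L) (V : L).
Hypotheses (valO : valuation_ring O) (Ok : forall c, O (kappa c)).
Variables (r q n J : nat) (a b beta : k) (cs : seq k) (y : 'I_n -> L).
Hypotheses (r_gt1 : (1 < r)%N) (r_neq0 : r%:R != 0 :> k).
Hypotheses (a0 : a != 0) (b0 : b != 0) (V0 : V != 0) (mV : vmax O V).
Hypothesis cs_a : 'X^r + a%:P = \prod_(c <- cs) ('X - c%:P).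
Hypothesis psi_y : psi r (kappa a) (kappa b) V = \prod_i ('X - (y i)%:P).
Hypotheses (qB : forall x y : L, (x - y) ^+ q = x ^+ q - y ^+ q) (q_gt0 : (0 < q)%N).
Hypothesis aq : a ^+ q = b.
Hypotheses (Jq : (J <= q)%N) (Jrq : (J * r.-1 <= q.+1)%N).

Let ringO : subring_set O := valO.1.

Let rooty i := root_psi psi_y i.

Let Oy i : O (y i).
Proof. exact: root_integral valO Ok r_gt1 b0 _ (rooty i) (vmax_mem mV). Qed.

Let congr_mod (x x' : L) := exists2 w, O w & x - x' = w * V ^+ J.

Let congr_high j x x' w : (J <= j)%N -> O w -> x - x' = w * V ^+ j -> congr_mod x x'.
Proof.
move=> le_Jj Ow e; exists (w * V ^+ (j - J)).
  by apply: subring_setM => //; apply: subring_setX => //; exact: vmax_mem.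
by rewrite e -mulrA -exprD subnK.
Qed.

Let congr_prod (I : Type) (s : seq I) (F G : I -> L) :
  (forall i, O (F i)) -> (forall i, O (G i)) -> (forall i, congr_mod (F i) (G i)) ->
  congr_mod (\prod_(i <- s) F i) (\prod_(i <- s) G i).
Proof.
move=> OF OG FG; elim: s => [|i s [w Ow IH]].
  by rewrite !big_nil; exists 0; [exact: subring_set0 | rewrite subrr mul0r].
have [v Ov e] := FG i; rewrite !big_cons.
exists (v * (\prod_(j <- s) F j) + G i * w).
  apply: (subring_setD ringO); apply: (subring_setM ringO) => //.
  exact: (subring_set_prod ringO).
rewrite mulrDl mulrAC -e -mulrA -IH; ring.
Qed.

Let qN (c : k) : kappa (- c ^+ q) = kappa ((- c) ^+ q).
Proof.
rewrite rmorphXn !rmorphN rmorphXn -[- kappa c]sub0r qB expr0n gtn_eqF //.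
by rewrite sub0r.
Qed.

(** For a small root, y^(q+1) is itself a multiple of V^J. For a unit root near c, y^(q+1) - y c^q =
    y (y - c)^q is a multiple of V^q, so z = c^q serves. *)
Let root_cases i : exists z : k,
  [/\ z = 0 /\ vmax O (y i) \/ z ^+ r = - b /\ vunit O (y i)
    & congr_mod (y i ^+ q.+1) (y i * kappa z)].
Proof.
have [uy|my] := vunit_or_vmax (Oy i); last first.
  exists 0; split; first by left.
  have [u uu e] := small_root valO Ok r_gt1 a0 (rooty i) my.
  (* The factor (y^(r-1))^J = (u V)^J is split off from y^(q+1), which is possible as J (r-1) <=
     q+1. *)
  exists (u ^+ J * y i ^+ (q.+1 - J * r.-1)).
    apply: (subring_setM ringO); first exact: subring_setX (vunit_mem uu).
    exact: subring_setX.
  rewrite rmorph0 mulr0 subr0 mulrAC -exprMn -e -exprM [(r.-1 * J)%N]mulnC -exprD.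
  by rewrite subnKC.
have [c [ca [w Ow e]]] := unit_root valO Ok r_gt1 r_neq0 a0 (rooty i) mV cs_a uy.
(* From c^r = -a and additivity of the q-th power, (c^q)^r = -a^q = -b. *)
exists (c ^+ q); split.
  right; split=> //; apply: (fmorph_inj kappa).
  by rewrite -exprM mulnC exprM ca -qN aq.
apply: (@congr_high q _ _ (y i * w ^+ q)) => //.
  by apply: (subring_setM ringO) => //; exact: subring_setX.
by rewrite exprS rmorphXn -mulrBr -qB e exprMn mulrA.
Qed.

Lemma approximate_relation :
  \prod_i (y i ^+ q.+1 - 1) = kappa beta * (1 - V ^+ q.+1) ->
  exists z : 'I_n -> k,
  [/\ forall i, z i = 0 \/ z i ^+ r = - b, #|[set i | z i == 0]| = r.-1
    & exists2 w, O w & \prod_i (y i * kappa (z i) - 1) - kappa beta = w * V ^+ J].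
Proof.
move=> rel; have [z zP] := choice root_cases.
have zb i : z i = 0 \/ z i ^+ r = - b by have [[[]|[]]] := zP i; [left | right].
have zsmall i : (z i == 0) -> vmax O (y i).
  have [[[_ //]|[zr _]] _] := zP i; move=> /eqP z0; move: zr.
  rewrite z0 expr0n gtn_eqF ?(ltnW r_gt1) //.
  by move=> /esym/eqP; rewrite oppr_eq0 (negPf b0).
have zunit i : (z i != 0) -> vunit O (y i).
  by have [[[-> _]|[_ //]] _] := zP i; rewrite eqxx.
exists z; split=> //.
  have := @card_special_roots _ _ kappa O V r a b valO r_gt1 V0 _ _ psi_y [pred i | z i == 0].
  rewrite cardsE; apply; [by left | | by move=> i; exact: zunit].
  by move=> i /zsmall; exact: (small_root valO Ok r_gt1 a0 (rooty i)).
have O1 : O 1 by exact: subring_set1.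
have [|||w Ow e] := @congr_prod _ (index_enum 'I_n)
  (fun i => y i * kappa (z i) - 1) (fun i => y i ^+ q.+1 - 1).
- by move=> i; apply: (subring_setB ringO) => //; apply: (subring_setM ringO).
- by move=> i; apply: (subring_setB ringO) => //; exact: (subring_setX ringO).
- move=> i; have [_ [w Ow e]] := zP i; exists (- w); first exact: subring_setN.
  by rewrite mulNr -e; ring.
(* The term beta V^(q+1) of the given relation is absorbed into the error. *)
exists (w - kappa beta * V ^+ (q.+1 - J)).
  apply: (subring_setB ringO) => //; apply: (subring_setM ringO) => //.
  by apply: subring_setX => //; exact: vmax_mem.
rewrite mulrBl -e rel -mulrA -exprD subnK; last exact: leqW.
by ring.
Qed.

End ApproximateRelation.

(** * Orders, degrees and integrality in k[V] *)

Section DegreeBound.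
Variables (k L : fieldType) (iota : {rmorphism {poly k} -> L}).
Hypothesis iota_eq0 : forall p, iota p = 0 -> p = 0.

Let kappa : {rmorphism k -> L} := iota \o polyC.
Let V := iota 'X.

Let V0 : V != 0.
Proof. by apply/eqP => /iota_eq0/eqP; rewrite polyX_eq0. Qed.

(** A nonzero polynomial vanishes at 0 to order at most its degree; the first is at least J and the
    second at most D < J. *)
Lemma poly_order_le_degree (O O' : set L) (p : {poly k}) (J D : nat) :
  valuation_ring O -> (forall c, O (kappa c)) -> vmax O V ->
  valuation_ring O' -> (forall c, O' (kappa c)) -> vmax O' V^-1 ->
  (exists2 w, O w & iota p = w * V ^+ J) -> O' (iota p * V^-1 ^+ D) -> (D < J)%N ->
  p = 0.
Proof.
move=> valO Ok mV valO' Ok' mV' [w Ow pw] O'p lt_DJ; apply/eqP; apply: contraT => p0.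
have [i lt_ip ip] := vassoc_poly_zero valO Ok mV p0.
have le_Ji : (J <= i)%N.
  by apply: (vassoc_exp_le valO mV V0 Ow); rewrite -pw; exact: vassoc_sym.
have := vassoc_poly_infinity iota_eq0 valO' Ok' mV' p0; set d := (size p).-1 => dp.
have : (d <= D)%N.
  apply: (vassoc_exp_le valO' mV' _ O'p); first by rewrite invr_eq0.
  apply: vassoc_sym => //.
  have : vassoc O' (iota p * V^-1 ^+ d * V^-1 ^+ D) (V ^+ d * V^-1 ^+ d * V^-1 ^+ D).
    by apply: vassocM (vassoc_refl _ _) => //; apply: vassocM (vassoc_refl _ _).
  by rewrite -exprMn divff // expr1n mul1r mulrAC.
by move: lt_ip; rewrite -/d; lia.
Qed.

(* A denominator would lie in the maximal ideal of some valuation ring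
   containing k[V]. *)
Lemma integral_fraction (N : L) (u v : {poly k}) : v != 0 -> N * iota v = iota u ->
  (forall O, valuation_ring O -> (forall p, O (iota p)) -> O N) ->
  exists p, N = iota p.
Proof.
move=> v0 Nv ON; set g := gcdp u v.
have g0 : g != 0 by rewrite gcdp_eq0 negb_and v0 orbT.
have ug := divpK (dvdp_gcdl u v); have vg := divpK (dvdp_gcdr u v).
set u' := u %/ gcdp u v in ug; set v' := v %/ gcdp u v in vg.
have Nv' : N * iota v' = iota u'.
  have ig0 : iota g != 0 by apply: contra_neq g0 => /iota_eq0.
  by apply: (mulIf ig0); rewrite -mulrA -!rmorphM ug vg.
have cop : coprimep u' v' by apply: coprimep_div_gcd; rewrite v0 orbT.
have v'0 : v' != 0 by apply: contraNneq v0 => v'0; rewrite -vg v'0 mul0r.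
have [lt_v|le_v] := ltnP 1 (size v').
  have [O [valO Oi mv]] := valuation_over_poly iota_eq0 lt_v.
  have mu : vmax O (iota u') by rewrite -Nv'; apply: vmaxMl => //; exact: ON.
  have /Bezout_eq1_coprimepP[[s t] /= e] := cop.
  exfalso; apply: (@vunit_vmaxN _ O 1); first exact: vunit1.
  rewrite -(rmorph1 iota) -e rmorphD !rmorphM.
  by apply: vmaxD => //; apply: vmaxMl.
have [c c0 v'c] : exists2 c, c != 0 & v' = c%:P.
  by exists v'`_0; [rewrite -polyC_eq0 -size1_polyC | rewrite -size1_polyC].
exists (u' * c^-1%:P); rewrite rmorphM -Nv' v'c -mulrA -rmorphM -polyCM divff //.
by rewrite rmorph1 mulr1.
Qed.

End DegreeBound.

(** At a pole y^(r-1) has the order of V, so y/V has that of y^-(r-2). This bounds the degree of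
    symmetric expressions in the roots. *)
Lemma root_over_V_infinity (k L : fieldType) (kappa : {rmorphism k -> L}) (O : set L) (V : L)
    (r : nat) (a b : k) (y : L) :
  valuation_ring O -> (forall c, O (kappa c)) -> (1 < r)%N -> b != 0 -> V != 0 ->
  vmax O V^-1 -> root (psi r (kappa a) (kappa b) V) y -> O (y * V^-1).
Proof.
move=> valO Ok r1 b0 V0 mV ry; have ringO := valO.1.
have [Oy|nOy] := pselect (O y); first exact: subring_setM (vmax_mem mV).
have [u uu e] := pole_root valO Ok r1 b0 ry nOy.
have y0 : y != 0 by apply: contra_notN nOy => /eqP->; exact: subring_set0.
have -> : y * V^-1 = u * y^-1 ^+ r.-2.
  apply: (mulIf V0); apply: (mulIf (expf_neq0 r.-2 y0)).
  rewrite mulfVK // -exprS; have -> : r.-2.+1 = r.-1 by lia.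
  by rewrite e -[RHS]mulrA mulrACA -exprMn mulVf // expr1n mulr1.
apply: (subring_setM ringO (vunit_mem uu)); apply: (subring_setX ringO).
exact: vmax_mem (vmax_inv valO nOy).
Qed.

(** * The exact relation and its impossibility *)

Section Contradiction.
Variables (k : fieldType) (L : splittingFieldType {fraction {poly k}}).
Variables (r : nat) (a b : k).
Hypotheses (r_gt2 : (2 < r)%N) (r_neq0 : r%:R != 0 :> k).
Hypotheses (a0 : a != 0) (b0 : b != 0).

Let iota : {rmorphism {poly k} -> L} := in_alg L \o @tofrac {poly k}.
Let kappa : {rmorphism k -> L} := iota \o polyC.
Let V := iota 'X.
Let Psi : {poly L} := psi r (kappa a) (kappa b) V.
Let n := (r.-1 + r)%N.

Let r_gt1 : (1 < r)%N. Proof. exact: ltnW. Qed.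

Let V0 : V != 0.
Proof. by rewrite fmorph_eq0 tofrac_eq0 polyX_eq0. Qed.

Variable y : 'I_n -> L.
Hypotheses (Psi_y : Psi = \prod_i ('X - (y i)%:P)) (inj_y : injective y).
Hypothesis galL : galois 1 {:L}.

Let root_y i : root Psi (y i). Proof. exact: (root_psi Psi_y). Qed.

Lemma gal_perm (g : gal_of {:L}) :
  exists p : {perm 'I_n}, forall i, g (y i) = y (p i).
Proof.
have gPsi : map_poly g Psi = Psi.
  by rewrite /Psi map_psi /= !gal_iota.
have /choice[f fP] i : exists j, g (y i) = y j.
  have : root Psi (g (y i)) by rewrite -gPsi fmorph_root.
  rewrite Psi_y /root horner_prod prodf_seq_eq0 => /hasP[j _ /=].
  by rewrite hornerXsubC subr_eq0 => /eqP e; exists j.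
have inj_f : injective f.
  move=> i j fij; apply: inj_y; have : g (y i) = g (y j) by rewrite !fP fij.
  exact: fmorph_inj.
by exists (perm inj_f) => i; rewrite permE.
Qed.

(** The product of all [E s] is Galois invariant and lies in every valuation ring over k[V], so it
    is a polynomial in V. Its degree is at most D = n n!, while for large q the factor at s = 1
    vanishes at V = 0 to order D + 1. Hence the product is zero and some [E s] vanishes. *)
Lemma exists_relation (q : nat) (beta : k) (cs : seq k) :
  'X^r + a%:P = \prod_(c <- cs) ('X - c%:P) ->
  [pchar k].-nat q -> a ^+ q = b ->
  (r.-1 * (n * n`!).+1 <= q)%N ->
  \prod_i (y i ^+ q.+1 - 1) = kappa beta * (1 - V ^+ q.+1) ->
  exists z : 'I_n -> k,
  [/\ forall i, z i = 0 \/ z i ^+ r = - b, #|[set i | z i == 0]| = r.-1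
    & exists s : {perm 'I_n}, \prod_i (y (s i) * kappa (z i) - 1) = kappa beta].
Proof.
move=> cs_a qchar aq q_large rel; set D := (n * n`!)%N in q_large.
have iota0 := @iota_inj0 k L.
have sX : (1 < size ('X : {poly k}))%N by rewrite size_polyX.
have [O [valO Oi mV]] := valuation_over_poly iota0 sX.
have Ok c : O (kappa c) by exact: Oi.
have qB (u v : L) : (u - v) ^+ q = u ^+ q - v ^+ q.
  have qcharL : [pchar L].-nat q by rewrite (eq_pnat _ (fmorph_pchar kappa)).
  by rewrite exprDn_pchar // exprNn_pchar.
have q_gt0 : (0 < q)%N by case/andP: qchar.
have le_Jq : (D.+1 <= q)%N by apply: leq_trans q_large; rewrite leq_pmull //; lia.
have le_Jrq : (D.+1 * r.-1 <= q.+1)%N by rewrite mulnC (leq_trans q_large).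
have [z [zP cardz [w Ow zw]]] := approximate_relation valO Ok r_gt1 r_neq0 a0 b0 V0 mV cs_a
  Psi_y qB q_gt0 aq le_Jq le_Jrq rel.
exists z; split=> //.
pose E (s : {perm 'I_n}) := \prod_i (y (s i) * kappa (z i) - 1) - kappa beta.
suff /eqP : \prod_s E s = 0.
  rewrite prodf_seq_eq0 => /hasP[s _ /= /eqP Es0]; exists s.
  by apply/eqP; rewrite -subr_eq0 -/(E s) Es0.
have gN (g : gal_of {:L}) : g (\prod_s E s) = \prod_s E s.
  have [p gp] := gal_perm g; rewrite rmorph_prod [RHS](reindex_inj (mulIg p)).
  apply: eq_bigr => s _; rewrite /E rmorphB rmorph_prod; congr (_ - _); last exact: gal_iota.
  apply: eq_bigr => i _; rewrite rmorphB rmorphM rmorph1 permM.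
  by congr (_ * _ - _); [exact: gp | exact: gal_iota].
have OE (O' : set L) s : valuation_ring O' -> (forall c, O' (kappa c)) -> O' V -> O' (E s).
  move=> valO' Ok' OV; have ringO' := valO'.1.
  apply: (subring_setB ringO') => //; apply: (subring_set_prod ringO') => i _.
  apply: (subring_setB ringO'); last exact: subring_set1.
  by apply: (subring_setM ringO') => //; exact: (root_integral valO' Ok' r_gt1 b0 (root_y _)).
have [p Np] : exists p, \prod_s E s = iota p.
  have : \prod_s E s \in fixedField 'Gal({:L} / 1)%g.
    by apply/fixedFieldP; rewrite ?memvf // => g _; exact: gN.
  rewrite (galois_fixedField galL) => /vlineP[c Nc].
  have [u [v [v0 cE]]] := fraction_numden c.
  apply: (integral_fraction iota0 v0 (u := u)).
    rewrite Nc cE /= -scalerAl mul1r scalerA divfK // tofrac_eq0 //.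
  move=> O' valO' Oi'; apply: (subring_set_prod valO'.1) => s _.
  by apply: OE => //; [move=> c'; exact: Oi' | exact: Oi'].
have [O' [valO' Ok' mV']] := valuation_infinity iota0.
rewrite Np; suff -> : p = 0 by rewrite rmorph0.
apply: (poly_order_le_degree iota0 valO Ok mV valO' Ok' mV' _ _ (ltnSn D)).
- rewrite -Np (bigD1 1%g) //=.
  exists (w * \prod_(s | s != 1%g) E s).
    apply: (subring_setM valO.1) => //; apply: (subring_set_prod valO.1) => s _.
    by apply: OE => //; exact: vmax_mem.
  rewrite mulrAC -zw; congr ((_ - _) * _).
  by apply: eq_bigr => i _; rewrite perm1.
(* There are n! factors, and each has a pole of order at most n at infinity because every y_i / V is
   integral there. *)
- have -> : iota p * V^-1 ^+ D = \prod_s (E s * V^-1 ^+ n).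
    rewrite -Np big_split /= prodr_const /D exprM; congr (_ * _ ^+ _).
    by rewrite -card_Sn; apply: eq_card => s; rewrite inE.
  have ringO' := valO'.1; have OV' := vmax_mem mV'.
  apply: (subring_set_prod ringO') => s _.
  rewrite mulrBl; apply: (subring_setB ringO'); last first.
    by apply: (subring_setM ringO' (Ok' beta)); exact: (subring_setX ringO').
  rewrite -[n in V^-1 ^+ n]card_ord -prodr_const -big_split /=.
  apply: (subring_set_prod ringO') => i _; rewrite mulrBl mul1r mulrAC.
  apply: (subring_setB ringO') => //; apply: (subring_setM ringO') (Ok' (z i)).
  exact: (root_over_V_infinity valO' Ok' r_gt1 b0 V0 mV' (root_y _)).
Qed.

Hypothesis ab1 : a * b != 1.

(** Each Galois automorphism carries the relation to the same relation in permuted roots, so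
    [poles_of_relation] yields the dichotomy of [no_block] for the whole group. *)
Lemma no_relation (z : 'I_n -> k) (beta : k) :
  (forall i, z i = 0 \/ z i ^+ r = - b) -> #|[set i | z i == 0]| = r.-1 -> beta != 0 ->
  \prod_i (y i * kappa (z i) - 1) <> kappa beta.
Proof.
move=> zP cardz beta0 rel.
have [O [valO Ok mV]] := valuation_infinity (@iota_inj0 k L).
pose G : {set {perm 'I_n}} := [set p : {perm 'I_n} |
  `[< exists2 g : gal_of {:L}, g \in 'Gal({:L} / 1)%g & forall i, g (y i) = y (p i) >]].
have GP (p : {perm 'I_n}) : reflect (exists2 g : gal_of {:L},
    g \in 'Gal({:L} / 1)%g & forall i, g (y i) = y (p i)) (p \in G) by rewrite inE; exact: asboolP.
have PsiG (p : {perm 'I_n}) : Psi = \prod_i ('X - (y (p i))%:P).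
  by rewrite Psi_y (reindex_inj (@perm_inj _ p)).
have poles (p : {perm 'I_n}) : p \in G -> let Zp := [set i | ~~ `[< O (y (p i)) >]] in
    #|Zp| = r.-1 /\ (Zp = [set i | z i == 0] \/ [disjoint Zp & [set i | z i == 0]]).
  move=> /GP[g gG gy].
  have relp : \prod_i (y (p i) * kappa (z i) - 1) = kappa beta.
    rewrite -[RHS](gal_iota g beta%:P) -[iota _]rel rmorph_prod; apply: eq_bigr => i _.
    by rewrite rmorphB rmorphM rmorph1 /= gy gal_iota.
  exact: (poles_of_relation valO Ok r_gt1 r_neq0 b0 ab1 V0 mV (PsiG p) zP cardz beta0 relp).
have G1 : 1%g \in G.
  by apply/GP; exists 1%g; rewrite ?group1 // => i; rewrite gal_id perm1.
pose Z := [set i | ~~ `[< O (y i) >]].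
apply: (@no_block r n G Z [set i | z i == 0] r_gt2 erefl) => //.
- move=> p s /GP[g gG gy] /GP[h hG hy]; apply/GP; exists (g * h)%g; first exact: groupM.
  by move=> i; rewrite galM ?memvf // gy hy permM.
- move=> i j; have nor : normalField 1 {:L} by have /and3P[] := galL.
  have [g gG gij] := galois_transitive r_gt1 ab1 (root_y i) (root_y j) nor.
  have [p gp] := gal_perm g; exists p; first by apply/GP; exists g.
  by apply: inj_y; rewrite -gp.
- have [<- _] := poles _ G1; congr #|pred_of_set _|.
  by apply/setP => i; rewrite !inE perm1.
- move=> p pG /=; have [_] := poles _ pG.
  suff -> : [set i | p i \in Z] = [set i | ~~ `[< O (y (p i)) >]] by [].
  by apply/setP => i; rewrite !inE.
Qed.

End Contradiction.

(** The splitting field is chosen only inside the proof, so the relation is demanded over every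
    field where psi splits. *)
Theorem no_large_relation (k : fieldType) (r q : nat) (a b beta : k) (cs : seq k) :
  (2 < r)%N -> r%:R != 0 :> k -> a != 0 -> b != 0 -> a * b != 1 -> beta != 0 ->
  'X^r + a%:P = \prod_(c <- cs) ('X - c%:P) ->
  [pchar k].-nat q -> a ^+ q = b ->
  let n := (r.-1 + r)%N in
  (forall (L : fieldType) (iota : {rmorphism {poly k} -> L}) (y : 'I_n -> L),
     psi r (iota a%:P) (iota b%:P) (iota 'X) = \prod_i ('X - (y i)%:P) ->
     \prod_i (y i ^+ q.+1 - 1) = iota beta%:P * (1 - iota 'X ^+ q.+1)) ->
  (q < r.-1 * (n * n`!).+1)%N.
Proof.
move=> r2 r0 a0 b0 ab1 beta0 cs_a qchar aq n rel; rewrite ltnNge; apply/negP => q_large.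
have r1 : (1 < r)%N by exact: ltnW.
pose P : {poly {fraction {poly k}}} := psi r (tofrac a%:P) (tofrac b%:P) (tofrac 'X).
have P0 : P != 0 by rewrite monic_neq0 // (psi_monic _ _ _ r1).1.
have [L splitL] := exists_splitting_field P0; rewrite map_psi in splitL.
have [y [Psi_y inj_y galL]] := exists_roots r1 a0 ab1 splitL.
have [z [zP cardz [s zs]]] :=
  exists_relation r2 r0 a0 b0 Psi_y inj_y galL cs_a qchar aq q_large (rel _ _ _ Psi_y).
apply: (@no_relation k L r a b r2 r0 b0 (y \o s) _ _ galL ab1 z beta zP cardz beta0 zs).
  by rewrite Psi_y (reindex_inj (@perm_inj _ s)).
exact: inj_comp inj_y (@perm_inj _ s).
Qed.

(** * Permutation binomials *)

Lemma dvdp_genPoly_split (K : finFieldType) (p : {poly K}) :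
  p %| 'X^#|K| - 'X -> exists2 s : seq K, uniq s & p %= \prod_(x <- s) ('X - x%:P).
Proof.
rewrite finField_genPoly -big_enum => /dvdp_prod_XsubC[m pm].
by exists (mask m (enum K)) => //; rewrite mask_uniq ?enum_uniq.
Qed.

Section PermutationBinomial.
Variables (K : finFieldType) (q r : nat) (a : K).
Hypotheses (cardK : #|K| = (q ^ 2)%N) (q_gt1 : (1 < q)%N) (r_gt0 : (0 < r)%N).
Hypotheses (qchar : [pchar K].-nat q).
Hypothesis permf : permutation_polynomial (a *: 'X + 'X^(r * (q - 1) + 1)).

Let q2E : (q ^ 2 = (q - 1) * q.+1 + 1)%N.
Proof. by rewrite -[in LHS](subnK (ltnW q_gt1)); nia. Qed.

Let genPolyE : 'X^#|K| - 'X = 'X * ('X^((q - 1) * q.+1) - 1) :> {poly K}.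
Proof. by rewrite cardK q2E addn1 exprS mulrBr mulr1. Qed.

Let dvd_unity : ('X^((q - 1) * q.+1) - 1 : {poly K}) %| 'X^#|K| - 'X.
Proof. by rewrite genPolyE dvdp_mull. Qed.

Lemma unity_roots : exists2 us : seq K, uniq us & 'X^(q.+1) - 1 = \prod_(u <- us) ('X - u%:P).
Proof.
have [us uus Dus] : exists2 us : seq K, uniq us & 'X^(q.+1) - 1 %= \prod_(u <- us) ('X - u%:P).
  apply: dvdp_genPoly_split; apply: dvdp_trans dvd_unity.
  have := subrXX ('X^(q.+1)) (1 : {poly K}) (q - 1); rewrite expr1n -exprM mulnC => ->.
  exact: dvdp_mulr.
exists us => //; apply/eqP; rewrite -eqp_monic ?monic_prod_XsubC //.
by rewrite monicXnsubC.
Qed.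

(** As u^(q+1) = 1, the polynomial X^(q-1) - u divides X^((q-1)(q+1)) - 1 and so splits in K. *)
Lemma unity_root_power (u : K) : u ^+ q.+1 = 1 -> exists2 x, x != 0 & x ^+ (q - 1) = u.
Proof.
move=> uq; have u0 : u != 0 by apply: contra_eq_neq uq => ->; rewrite expr0n eq_sym oner_eq0.
have q1 : (0 < q - 1)%N by rewrite subn_gt0.
have [s us Ds] : exists2 s : seq K, uniq s & 'X^(q - 1) - u%:P %= \prod_(x <- s) ('X - x%:P).
  apply: dvdp_genPoly_split; apply: dvdp_trans dvd_unity.
  have := subrXX ('X^(q - 1)) u%:P q.+1; rewrite -exprM -polyC_exp uq polyC1 => ->.
  exact: dvdp_mulr.
case: s us Ds => [|x s] _ Ds.
  by have := eqp_size Ds; rewrite big_nil size_poly1 size_XnsubC // => -[]; lia.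
have : root ('X^(q - 1) - u%:P) x by rewrite (eqp_root Ds) root_prod_XsubC mem_head.
rewrite /root !hornerE subr_eq0 => /eqP xu; exists x => //.
by apply: contraNneq u0 => x0; rewrite -xu x0 expr0n gtn_eqF.
Qed.

Let fE x : (a *: 'X + 'X^(r * (q - 1) + 1)).[x] = x * ((x ^+ (q - 1)) ^+ r + a).
Proof. by rewrite !hornerE addn1 exprS mulnC exprM mulrDr addrC; congr (_ + _); rewrite mulrC. Qed.

Let num (u : K) := u ^+ r.-1 * (u ^+ r + a).
Let den (u : K) := a ^+ q * u ^+ r + 1.

(** With u = x^(q-1), a zero would give f(x) = 0 = f(0). *)
Lemma permutation_num_neq0 u : u ^+ q.+1 = 1 -> u ^+ r + a != 0.
Proof.
move=> /unity_root_power[x x0 <-]; apply: contraNneq x0 => e.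
by apply/eqP; apply: (bij_inj permf); rewrite !fE e mulr0 mul0r.
Qed.

(** On mu the inverse of u is u^q, so (u^r + a)^q = u^(-r) + a^q. *)
Lemma permutation_denE u : u ^+ q.+1 = 1 -> den u = u ^+ r * (u ^+ r + a) ^+ q.
Proof.
move=> uq; rewrite /den exprDn_pchar // mulrDr -exprS -exprM mulnC exprM uq expr1n.
by rewrite addrC [a ^+ q * _]mulrC.
Qed.

Lemma permutation_den_neq0 u : u ^+ q.+1 = 1 -> den u != 0.
Proof.
move=> uq; rewrite permutation_denE // mulf_neq0 ?expf_neq0 ?permutation_num_neq0 //.
by apply: contra_eq_neq uq => ->; rewrite expr0n eq_sym oner_eq0.
Qed.

(** Surjectivity of f makes A/B surjective on the finite set mu, and counting turns this into a
    permutation. *)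
Lemma permutation_unity_roots (us : seq K) : uniq us ->
  'X^(q.+1) - 1 = \prod_(u <- us) ('X - u%:P) ->
  perm_eq us [seq num u / den u | u <- us].
Proof.
move=> uus usE.
have usP u : (u \in us) = (u ^+ q.+1 == 1).
  by rewrite -root_prod_XsubC -usE /root !hornerE subr_eq0.
have sub : {subset us <= [seq num u / den u | u <- us]}.
  (* At u = x^(q-1) the quotient A(u)/B(u) is the inverse of f(x)^(q-1), so f(x) is chosen with
     (q-1)-st power 1/v. *)
  move=> v; rewrite usP => /eqP vq; have vq' : v^-1 ^+ q.+1 = 1 by rewrite exprVn vq invr1.
  have [w w0 wv] := unity_root_power vq'.
  have [f' _ f'K] := permf; set x := f' w; have := f'K w; rewrite -/x fE => xw.
  set u := x ^+ (q - 1) in xw.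
  have x0 : x != 0 by apply: contraNneq w0 => x0; rewrite -xw x0 mul0r.
  have u0 : u != 0 by exact: expf_neq0.
  have uq : u ^+ q.+1 = 1.
    apply: (mulfI x0); rewrite -exprM mulr1 -exprS -addn1 -q2E -cardK.
    exact: expf_card.
  have t0 := permutation_num_neq0 uq.
  apply/mapP; exists u; first by rewrite usP uq.
  rewrite permutation_denE // -[v]invrK -wv -xw /num.
  have -> : (x * (u ^+ r + a)) ^+ (q - 1) = u * (u ^+ r + a) ^+ (q - 1) by rewrite exprMn.
  move: (u ^+ r + a) t0 => t t0.
  have -> : t ^+ q = t * t ^+ (q - 1) by rewrite -exprS subn1 prednK // ltnW.
  have -> : u ^+ r = u * u ^+ r.-1 by rewrite -exprS prednK.
  by field; rewrite u0 t0 !expf_neq0.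
have le_size : (size [seq num u / den u | u <- us] <= size us)%N by rewrite size_map.
apply: uniq_perm => //; first exact: leq_size_uniq uus sub le_size.
exact: (uniq_min_size uus sub le_size).2.
Qed.

(* Both sides are the resultant of X^(q+1) - 1 and psi. *)
Lemma permutation_root_identity n : exists2 beta : K, beta != 0 &
  forall (L : fieldType) (eta : {rmorphism K -> L}) (V : L) (y : 'I_n -> L),
    psi r (eta a) (eta (a ^+ q)) V = \prod_i ('X - (y i)%:P) ->
    \prod_i (y i ^+ q.+1 - 1) = eta beta * (1 - V ^+ q.+1).
Proof.
have [us uus usE] := unity_roots.
have usP u : u \in us -> u ^+ q.+1 = 1.
  by rewrite -root_prod_XsubC -usE /root !hornerE subr_eq0 => /eqP.
have perm_us := permutation_unity_roots uus usE.
(* [s] is the sign relating the product of u - x over mu to x^(q+1) - 1; it enters once for V and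
   once for each of the n roots. *)
pose s : K := (-1) ^+ size us.
exists (- (s ^+ n) * (s * \prod_(u <- us) den u)).
  rewrite !mulf_neq0 ?oppr_eq0 ?expf_neq0 ?oppr_eq0 ?oner_eq0 //.
  rewrite big_seq; elim/big_ind: _ => [|x y|u /usP]; first exact: oner_neq0.
    exact: mulf_neq0.
  exact: permutation_den_neq0.
move=> L eta V y psi_y.
have evalX (x : L) : \prod_(u <- us) (eta u - x) = eta s * (x ^+ q.+1 - 1).
  have : map_poly eta ('X^(q.+1) - 1) = \prod_(u <- us) ('X - (eta u)%:P).
    rewrite usE rmorph_prod; apply: eq_bigr => u _.
    by rewrite rmorphB /= map_polyX map_polyC.
  move=> /(congr1 (fun p => p.[x])); rewrite rmorphB /= map_polyXn rmorph1 horner_prod !hornerE => ->.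
  under [in RHS]eq_bigr => u _ do rewrite !hornerE.
  have -> : eta s = \prod_(u <- us) (- 1).
    by rewrite big_const_seq count_predT iter_mulr mulr1 /s rmorphXn rmorphN rmorph1.
  by rewrite -big_split /=; apply: eq_bigr => u _; rewrite mulN1r opprB.
have ss : eta s ^+ n * eta s ^+ n = 1.
  by rewrite -exprMn -rmorphM /s -exprMn mulrNN mulr1 expr1n rmorph1 expr1n.
have prodE : eta s ^+ n * \prod_i (y i ^+ q.+1 - 1)
    = eta (\prod_(u <- us) den u) * (eta s * (V ^+ q.+1 - 1)).
  rewrite -[n in eta s ^+ n]card_ord -prodr_const -big_split /=.
  under eq_bigr => i _ do rewrite -evalX.
  have <- : \prod_(u <- us) (eta (num u / den u) - V) = eta s * (V ^+ q.+1 - 1).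
    by rewrite -evalX [RHS](perm_big _ perm_us) /= big_map.
  (* Taken over i first, the product of the u - y_i is psi(u) = A(u) - V B(u), that is, B(u)
     (A(u)/B(u) - V). *)
  rewrite exchange_big /= rmorph_prod -big_split /=.
  rewrite big_seq [RHS]big_seq; apply: eq_bigr => u /usP uq.
  have := congr1 (fun p => p.[eta u]) psi_y; rewrite horner_psi horner_prod.
  under eq_bigr => i _ do rewrite hornerXsubC.
  move=> <-.
  rewrite mulrBr -rmorphM [den u * _]mulrC divfK ?permutation_den_neq0 //.
  by rewrite /num /den !(rmorphM, rmorphD, rmorphXn) rmorph1 [V * _]mulrC.
transitivity (eta s ^+ n * (eta s ^+ n * \prod_i (y i ^+ q.+1 - 1))).
  by rewrite mulrA ss mul1r.
rewrite prodE; clear evalX ss prodE; move: s (\prod_(u <- us) den u) => e d.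
by rewrite (rmorphM _ (- e ^+ n)) (rmorphM _ e) rmorphN rmorphXn; ring.
Qed.

End PermutationBinomial.

Lemma permutation_bound (K : finFieldType) (p e r : nat) (a : K) (q := (p ^ e)%N) :
  prime p -> (0 < e)%N -> #|K| = (q ^ 2)%N -> (2 < r)%N -> (r %| q.+1)%N ->
  a != 0 -> a ^+ q.+1 != 1 ->
  permutation_polynomial (a *: 'X + 'X^(r * (q - 1) + 1)) ->
  (q < r.-1 * ((r.-1 + r) * (r.-1 + r)`!).+1)%N.
Proof.
move=> p_pr e0 cardK r2 rq a0 aq1 permf.
have q1 : (1 < q)%N by rewrite -(exp1n e) ltn_exp2r ?prime_gt1.
have pK : p \in [pchar K] by apply: (card_finPcharP (n := (e * 2)%N)) => //; rewrite cardK -expnM.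
have qK : [pchar K].-nat q by rewrite pnatX pnatE // pK.
have [k [eps _]] := countable_algebraic_closure K.
(* If p divided r, it would divide both q + 1 and q = p^e, hence 1. *)
have r0 : r%:R != 0 :> k.
  rewrite -(rmorph_nat eps) fmorph_eq0 -(dvdn_pcharf pK); apply/negP => pr.
  have := dvdn_trans pr rq; rewrite -addn1 dvdn_addr; last exact: dvdn_exp.
  by rewrite dvdn1 => /eqP p1; rewrite p1 in p_pr.
have [cs csE] := closed_field_poly_normal ('X^r + (eps a)%:P : {poly k}).
have mon : ('X^r + (eps a)%:P : {poly k}) \is monic by rewrite monicXnaddC // ltnW // ltnW.
rewrite (monicP mon) scale1r in csE.
have [beta beta0 rel] := permutation_root_identity cardK q1 (ltnW (ltnW r2)) qK permf (r.-1 + r).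
apply: (@no_large_relation k r q (eps a) (eps (a ^+ q)) (eps beta) cs) => //.
- by rewrite fmorph_eq0.
- by rewrite fmorph_eq0 expf_neq0.
- by rewrite -rmorphM -exprS -(rmorph1 eps) (inj_eq (fmorph_inj eps)).
- by rewrite fmorph_eq0.
- by rewrite (eq_pnat _ (fmorph_pchar eps)).
- by rewrite rmorphXn.
- move=> L iota y psi_y.
  by have := rel L (iota \o polyC \o eps) _ y psi_y.
Qed.

Lemma finite_set_bounded_tag (F : nat -> finType) (N : nat) :
  finite_set [set qa : {q : nat & F q} | (tag qa < N)%N]%classic.
Proof.
apply: (@sub_finite_set _ _ (\bigcup_(i in [set i | (i < N)%N]) (existT F i @` setT))%classic).
  by move=> [q a] /= qN; exists q => //; exists a.
apply: bigcup_finite => [|i _]; first exact: finite_II.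
by apply: finite_image; exact: finite_finset.
Qed.

Local Open Scope classical_set_scope.

Theorem theorem1p5 (F : nat -> finFieldType) (hF : galois_fields F)
    (r : nat) (hr : (2 < r)%N) :
  finite_set [set qa : {q : nat & F (q ^ 2)%N} |
    let q := tag qa in
    let a := tagged qa in
    [/\ prime_power q, (r <= q)%N & (q + 1 = 0 %[mod r])%N] /\
    [/\ a != 0, a ^+ (q + 1) != 1 &
        permutation_polynomial (a *: 'X + 'X^(r * (q - 1) + 1))]].
Proof.
(* The bound on q depends on r alone, and each q leaves finitely many a. *)
pose N := (r.-1 * ((r.-1 + r) * (r.-1 + r)`!).+1)%N.
apply: sub_finite_set (finite_set_bounded_tag (fun q => F (q ^ 2)%N) N).
move=> [q a] /= [[[p [e [p_pr e0 qE]]] _ rq] [a0 aq1 permf]].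
have cardK : #|F (q ^ 2)%N| = (q ^ 2)%N.
  by apply: hF; exists p, (e * 2)%N; rewrite muln_gt0 e0 qE -expnM.
rewrite addn1 mod0n in rq; rewrite addn1 in aq1.
move: a cardK a0 aq1 permf; rewrite qE in rq *; move=> a cardK a0 aq1 permf.
by apply: (permutation_bound p_pr e0 cardK hr _ a0 aq1 permf); rewrite /dvdn rq.
Qed.
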